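(* Let $k\ge 1$ be an integer, $d\in\mathbb{N}\cup\{0\}$ and $m\in\mathbb{N}$. If a dynamical system $(X,\mathbb{Z}^k)$ satisfies $\dim(X)=d$ and $$\frac{\dim(\{x\in X: ax=x \text{ for all } a\in A\})}{[\mathbb{Z}^k:A]}<\frac m2$$ for every subgroup $A$ of $\mathbb{Z}^k$ with $[\mathbb{Z}^k:A]\le 2d$, then the set of continuous functions $f:X\to[0,1]^m$ such that $$f_{2d}:X\to([0,1]^m)^{[0,2d]^k\cap\mathbb{Z}^k},\qquad x\mapsto (f(ix))_{i\in[0,2d]^k\cap\mathbb{Z}^k}$$ is an embedding is comeagre in $C(X,[0,1]^m)$ with respect to the topology of the supremum norm.
   Context: $\mathbb{N}=\{1,2,\dots\}$. A dynamical system $(X,\mathbb{Z}^k)$ is a continuous action of $\mathbb{Z}^k$ on a compact metric space $X$, written $(g,x)\mapsto gx$. $C(X,[0,1]^m)$ is the space of continuous functions with the supremum norm. A set is comeagre if it is the complement of a countable union of nowhere dense sets. An embedding here is a continuous injective map. $[\mathbb{Z}^k:A]$ is the index of $A$. $\dim$ is Lebesgue covering dimension: for a finite open cover $\alpha$ of a compact metric space $Z$, $\operatorname{ord}(\alpha)=-1+\max_{x\in Z}\#\{U\in\alpha: x\in U\}$, $D(\alpha)=\min_{\beta\succ\alpha}\operatorname{ord}(\beta)$, where $\beta\succ\alpha$ means that $\beta$ is a finite open cover of $Z$ such that every $V\in\beta$ is contained in some $U\in\alpha$; and $\dim(Z)=\sup_\alpha D(\alpha)$ over finite open covers $\alpha$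 of $Z$ (with the usual convention $\dim(\emptyset)=-1$). *)

(* Defs.v *)
From mathcomp Require Import all_boot all_order all_algebra finmap.
From mathcomp Require Import all_classical all_reals all_analysis.
Import Order.TTheory GRing.Theory Num.Theory.
Import numFieldNormedType.Exports.

Set Implicit Arguments.
Unset Strict Implicit.
Unset Printing Implicit Defensive.

Local Open Scope classical_set_scope.
Local Open Scope ring_scope.

Section CoveringDimension.
Variables (R : realType) (T : topologicalType).
Implicit Types (alpha beta : {fset (set T)}) (x : T).

Definition open_cover alpha :=
  (forall U, U \in alpha -> open U) /\
  (forall x, exists2 U, U \in alpha & x \in U).

Definition refines beta alpha :=
  forall V, V \in beta -> exists2 U, U \in alpha & V `<=` U.

Definition multiplicity alpha x : nat := #|` [fset U in alpha | x \in U]%fset|.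

(* The element 0 matters only when T is empty: the maximum is then 0, so that
   the order of every cover is -1, whence dim = -1. *)
Definition cover_ord alpha : \bar R :=
  (-1 + ereal_sup (0 |` [set (multiplicity alpha x)%:R%:E | x in [set: T]]))%E.

(* The set below consists of integers >= -1, hence its infimum is a minimum. *)
Definition cover_D alpha : \bar R :=
  ereal_inf [set cover_ord beta | beta in
    [set beta | open_cover beta /\ refines beta alpha]].

Definition covering_dim : \bar R :=
  ereal_sup [set cover_D alpha | alpha in [set alpha | open_cover alpha]].

End CoveringDimension.

Section Baire.
Variable T : topologicalType.

Definition nowhere_dense (A : set T) := interior (closure A) = set0.

Definition comeagre (A : set T) :=
  exists F : nat -> set T,
    (forall n, nowhere_dense (F n)) /\ A = ~` \bigcup_n F n.

End Baire.

Definition embedding (X Y : topologicalType) (g : X -> Y) :=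
  continuous g /\ injective g.

(* Z^k is discrete, so an action is continuous iff each g acts continuously. *)
Definition continuous_action (k : nat) (X : topologicalType)
    (act : 'rV[int]_k -> X -> X) :=
  [/\ forall x, act 0 x = x,
      forall g h x, act (g + h) x = act g (act h x) &
      forall g, continuous (act g)].

(* Elements of zmodClosed V are the additive subgroups of V. *)
Definition cosets (V : zmodType) (A : zmodClosed V) : set (set V) :=
  [set [set h | h - g \in A] | g in [set: V]].

Definition has_index (V : zmodType) (A : zmodClosed V) (n : nat) : Prop :=
  (cosets A #= `I_n)%card.

Definition fixed_points (k : nat) (X : Type) (act : 'rV[int]_k -> X -> X)
    (A : zmodClosed 'rV[int]_k) : set X :=
  [set x | forall a, a \in A -> act a x = x].

Definition cube (R : realType) (m : nat) : set 'rV[R]_m :=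
  [set v | forall j, 0 <= v 0 j <= 1].
Arguments cube : clear implicits.

(* Continuous maps X -> Y with the topology of uniform convergence, that is,
   for Y = [0,1]^m, the topology of the supremum norm. *)
Definition Cunif (X : topologicalType) (Y : uniformType) : uniformType :=
  initial_topology (fun f : continuousType X Y => (f : {uniform X -> Y})).

Definition box (k N : nat) : set 'rV[int]_k :=
  [set i | forall j, 0 <= i 0 j <= N%:Z].
Arguments box : clear implicits.

Definition orbit_map (k : nat) (X : topologicalType) (Y : uniformType)
    (act : 'rV[int]_k -> X -> X) (N : nat) (f : Cunif X Y) :
    X -> {ptws set_type (box k N) -> Y} :=
  fun x i => (f : continuousType X Y) (act (\val i) x).
Arguments orbit_map {k X Y} act N f.

(* Main.v *)
Require Import Defs.
From HB Require Import structures.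
From mathcomp Require Import all_boot all_order all_algebra finmap.
From mathcomp Require Import all_classical all_reals all_analysis.
From mathcomp Require Import ring lra zify.
Import Order.TTheory GRing.Theory Num.Theory.
Import numFieldNormedType.Exports.

Set Implicit Arguments.
Unset Strict Implicit.
Unset Printing Implicit Defensive.

Local Open Scope classical_set_scope.
Local Open Scope ring_scope.

(** The map f_2d fails to separate x <> y exactly when f solves the equations
    f(i x) = f(i y), where i ranges over the box [0, 2d]^k. View these equations
    as the edges of a graph on the points of the two orbits. If r of the edges
    form a forest, then moving the values of f at the vertices independently
    gives the r differences f(i x) - f(i y) arbitrary small increments. So the
    equations hold nowhere, for suitable f close to any given one, on a family of
    pairs (x, y) of dimension less than r m. The proof compares r with that
    dimension.

    Counting. Let a be the number of points i x with i in the box. Enlarging the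
    box by one step adds a point to the set reached from x, unless this set is
    already the whole orbit ([orbit_box_stable]). Hence if a <= 2d the stabiliser
    of x has index a ([stab_index]), and every point with the same coincidences
    i y = i' y as x is fixed by it ([fixed_of_same_coincidences]). The stratum of
    such points then has dimension at most some e with 2 e < a m, by hypothesis;
    and if a > 2d this holds with e = d ([stratum_dim]).
    If no point i x equals a point i' y, let b be the number of points i y and e'
    the corresponding bound. Choosing one equation for each point on the larger
    side gives a star forest with max(a, b) edges, and e + e' < max(a, b) m.
    Otherwise y = g x for some g, and only the stratum of x matters. The edges
    join z to g z; in an arbitrary linear order of the vertices the edges with
    z < g z form a forest, and so do those with z > g z, so that one of them has
    r >= a / 2 edges and e < r m ([local_perturb]).

    Perturbing. On a set of dimension at most e, continuous functions are close
    to functions that factor through the nerve of a cover of multiplicity e + 1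
    ([nerve_approx]). The values of such functions can be covered by C M^e sets
    of diameter 1 / M, so a pigeonhole argument over a grid with L^n points,
    n > e, finds arbitrarily small vectors of R^n that are not values
    ([box_dim_avoid]). Translating the approximations of f near the different
    vertices, by amounts found by going along the forest ([forest_potential]),
    turns such a vector into a perturbation of f ([perturbation]).

    Assembling. Pairs of distinct points are covered by countably many compact
    sets of pairs: each is cut out by two small closed sets of a countable family
    and by a pattern of coincidences. The functions that separate all pairs of
    one such set form an open set ([open_box_separated]), and around every pair
    the set can be chosen so that this open set is dense ([dense_box_separated]). *)

(** * Bump functions on metric spaces *)

(** The function is the distance to [E] truncated at 1; the truncation gives a
    meaning to the distance to the empty set. *)
Lemma closed_zero_set (R : realType) (X : metricType R) (E : set X) :
  closed E -> exists phi : X -> R,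
    [/\ continuous phi, forall x, 0 <= phi x & forall x, phi x = 0 <-> E x].
Proof.
move=> clE.
pose D x := 1 |` [set mdist x z | z in E].
have D0 x : D x !=set0 by exists 1; left.
have lbD x : lbound (D x) 0.
  by move=> _ [->|[z _ <-]]; [exact: ler01 | exact: mdist_ge0].
have hD x : has_lbound (D x) by exists 0.
pose phi x := inf (D x).
have phi1 x : phi x <= 1 by apply: ge_inf => //; left.
have phiL x y : phi x <= mdist x y + phi y.
  rewrite addrC -lerBlDr; apply: lb_le_inf => // _ [->|[z Ez <-]].
    by rewrite lerBlDr (le_trans (phi1 x))// lerDl mdist_ge0.
  rewrite lerBlDr addrC; apply: (le_trans _ (metric_triangle x y z)).
  by apply: ge_inf => //; right; exists z.
have phi0 x : 0 <= phi x by exact: lb_le_inf.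
exists phi; split => // x.
- apply/cvgrPdist_lt => e e0; near=> y.
  have xy : mdist x y < e.
    by near: y; apply/metricType_numDomainType.nbhs_mdistP; exists e.
  apply: le_lt_trans xy.
  have := phiL y x; rewrite metric_sym => yx; have xy := phiL x y.
  by rewrite ler_norml; apply/andP; split; lra.
- split=> [phix0|Ex]; last first.
    apply/eqP; rewrite eq_le phi0 andbT.
    by apply: ge_inf => //; right; exists x => //; exact: mdistxx.
  apply: clE => A /metricType_numDomainType.nbhs_mdistP[e /= e0 eA].
  have : inf (D x) < Num.min e 1 by rewrite -/(phi x) phix0 lt_min e0 ltr01.
  case/(inf_lt (D0 x)) => _ [->|[z Ez <-]].
    by rewrite lt_min ltxx andbF.
  by rewrite lt_min => /andP[xz _]; exists z; split => //; exact: eA.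
Unshelve. all: by end_near. Qed.

Lemma continuous_sumr (R : realType) (X : topologicalType) (I : Type)
    (r : seq I) (P : pred I) (F : I -> X -> R) :
  (forall i, P i -> continuous (F i)) ->
  continuous (fun x => \sum_(i <- r | P i) F i x).
Proof. by move=> cF; apply: continuous_big => //; exact: add_continuous. Qed.

Lemma closed_separation (R : realType) (X : metricType R) (A B : set X) :
  closed A -> closed B -> (forall x, A x -> B x -> False) ->
  exists chi : X -> R, [/\ continuous chi, forall x, 0 <= chi x <= 1,
    forall x, A x -> chi x = 1 & forall x, B x -> chi x = 0].
Proof.
move=> /closed_zero_set[a [ca a0 aA]] /closed_zero_set[b [cb b0 bB]] AB.
have ab0 x : 0 < a x + b x.
  rewrite lt_neqAle addr_ge0// andbT eq_sym paddr_eq0//.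
  by apply/negP => /andP[/eqP/aA Ax /eqP/bB]; exact: AB.
exists (fun x => b x / (a x + b x)); split => x.
- apply: cvgM; first exact: cb.
  by apply: cvgV; [rewrite gt_eqF | apply: cvgD; [exact: ca|exact: cb]].
- by rewrite divr_ge0 ?(ltW (ab0 x))//= ler_pdivrMr// mul1r lerDr.
- by move/aA => ax0; rewrite ax0 add0r divff// gt_eqF//; move: (ab0 x); rewrite ax0 add0r.
- by move/bB => ->; rewrite mul0r.
Qed.

Definition clamp (R : realType) (e t : R) := Num.max (- e) (Num.min e t).

Lemma clampP (R : realType) (e t : R) : 0 <= e -> `|clamp e t| <= e.
Proof.
by move=> e0; rewrite ler_norml /clamp le_max lexx/= ge_max ge_min lexx /= andbT; lra.
Qed.

Lemma clamp_id (R : realType) (e t : R) : `|t| <= e -> clamp e t = t.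
Proof.
by rewrite ler_norml /clamp => /andP[? ?]; rewrite min_r// max_r.
Qed.

Lemma continuous_clamp (R : realType) (X : topologicalType) e (f : X -> R) :
  continuous f -> continuous (fun x => clamp e (f x)).
Proof.
move=> cf x; apply: (@continuous_max R X (cst (- e)) (fun x => Num.min e (f x))).
  exact: cvg_cst.
by apply: (@continuous_min R X (cst e) f); [exact: cvg_cst|exact: cf].
Qed.

(** * Dimension of subsets by ambient open covers *)

(** The covering dimension of [E] is at most [e], expressed by open sets of [X]: the
    partitions of unity used below have to be defined on all of [X], while the
    multiplicity of the cover only matters at the points of [E]. Covers are
    indexed families, so that repeated members count with their multiplicity. *)
Definition dim_le (X : topologicalType) (E : set X) (e : nat) :=
  forall (J : finType) (W : J -> set X),
    (forall j, open (W j)) -> (forall x, E x -> exists j, W j x) ->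
    exists (I : finType) (V : I -> set X) (z : I -> J),
      [/\ forall i, open (V i), forall i, V i `<=` W (z i),
          forall x, E x -> exists i, V i x &
          forall x, E x -> (#|[pred i | `[< V i x >]]| <= e.+1)%N].

(** Closedness turns a cover of [E'] into a cover of [E] by adding the complement
    of [E']; the members of a refinement that lie in this complement are of no use
    for [E'] and can be dropped. *)
Lemma dim_le_closed (X : topologicalType) (E E' : set X) e :
  closed E' -> E' `<=` E -> dim_le E e -> dim_le E' e.
Proof.
move=> clE' E'E dimE J W oW covW.
pose W' (o : option J) := if o is Some j then W j else ~` E'.
have [|x _|I [V [z [oV VW covV multV]]]] := dimE _ W'.
- by case=> [j|]; [exact: oW | exact: closed_openC].
- case: (pselect (E' x)) => [/covW[j Wj]|nE']; first by exists (Some j).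
  by exists None.
have zP (i : {i : I | isSome (z i)}) : exists j, z (val i) = Some j.
  by case: i => i /=; case: (z i) => // j _; exists j.
have [z' z'P] := choice zP.
exists {i : I | isSome (z i)}, (V \o val), z'; split => [i|i|x E'x|x E'x].
- exact: oV.
- by apply: subset_trans (VW (val i)) _; rewrite z'P.
- have [i Vix] := covV x (E'E _ E'x).
  have zi : isSome (z i).
    by move: (VW i x Vix); rewrite /W'; case: (z i) => //= /(_ E'x).
  by exists (exist _ i zi).
- apply: leq_trans (multV x (E'E _ E'x)).
  rewrite -(fintype.card_image val_inj); apply: subset_leq_card.
  by apply/fintype.subsetP => y /fintype.imageP[i + ->]; rewrite !inE.
Qed.

(** The statement covers both the whole space, with [iota] the identity, and a
    subspace, with [iota] the inclusion. *)
Lemma dim_le_range (R : realType) (X T : topologicalType) (iota : T -> X) e :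
  continuous iota ->
  (forall U : set T, open U -> exists2 U', open U' & U = iota @^-1` U') ->
  (covering_dim R T < e.+1%:R%:E)%E -> dim_le (range iota) e.
Proof.
move=> ciota indT dimT J W oW covW.
pose alpha := [fset iota @^-1` (W j) | j : J]%fset.
have calpha : open_cover alpha.
  split=> [_ /imfsetP[j _ ->]|t].
    by apply: open_comp => // x _; exact: ciota.
  have [|j Wj] := covW (iota t); first by exists t.
  by exists (iota @^-1` W j); [apply/imfsetP; exists j | rewrite inE].
have : (cover_D R alpha < e.+1%:R%:E)%E.
  by apply: le_lt_trans dimT; apply: ereal_sup_ubound; exists alpha.
case/ereal_inf_lt => _ [beta [[obeta cbeta] rbeta] <-] ordb.
have multb t : (multiplicity beta t <= e.+1)%N.
  rewrite leqNgt; apply/negP => lt.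
  move: ordb; rewrite ltNge => /negP; apply.
  have : ((multiplicity beta t)%:R%:E <= ereal_sup (0 |`
      [set (multiplicity beta x)%:R%:E | x in [set: T]]) :> \bar R)%E.
    by apply: ereal_sup_ubound; right; exists t.
  rewrite /cover_ord; move: (ereal_sup _) => [s||] //=;
    last by rewrite addey// !leey.
  rewrite lee_fin -EFinD lee_fin => sb.
  have : e.+2%:R <= s by apply: le_trans sb; rewrite ler_nat.
  rewrite -[in X in X -> _](addn1 e.+1) natrD; lra.
have vP (i : beta) : exists p : set X * J,
    [/\ open p.1, val i = iota @^-1` p.1 & val i `<=` iota @^-1` W p.2].
  have [U' oU' iU'] := indT _ (obeta _ (valP i)).
  have [_ /imfsetP[j _ ->] sij] := rbeta _ (valP i).
  by exists (U', j).
have [v {}vP] := choice vP.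
exists (fset_sub_type beta : finType).
 exists (fun i => (v i).1 `&` W (v i).2).
 exists (fun i => (v i).2).
split=> [i|i|_ [t _ <-]|_ [t _ <-]].
- by apply: openI; [have [] := vP i | exact: oW].
- exact: subIsetr.
- have [U Ub /set_mem Ut] := cbeta t.
  have [_ iU sU] := vP [` Ub]%fset.
  exists [` Ub]%fset; split; last exact: (sU t).
  by move: Ut; rewrite [X in X t -> _]iU.
- apply: leq_trans (multb t).
  rewrite cardE -(size_map val); apply: uniq_leq_size.
    by rewrite map_inj_uniq ?enum_uniq//; exact: val_inj.
  move=> _ /mapP[i + ->]; rewrite mem_enum => /asboolP[Vi _].
  rewrite in_fset; apply/andP; split => /=.
    exact: valP.
  by have [_ iU _] := vP i; apply: mem_set; rewrite iU.
Qed.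

(** * Approximation through the nerve of a cover *)

(** The joint image of [S] under the functions [H k] is covered by at most
    [C * M ^ e] sets of diameter at most [1 / M], for all [M]: its upper box
    dimension is at most [e], with an explicit constant. The pieces are given by
    the fibres of a labelling of the points of [S]. *)
Definition box_dim_le (R : realType) (P Q : Type) (S : set P)
    (H : Q -> P -> R) (e : nat) :=
  exists C : nat, forall M : nat, (0 < M)%N ->
    exists (T : finType) (lab : P -> T), (#|T| <= C * M ^ e)%N /\
      forall p p', S p -> S p' -> lab p = lab p' ->
        forall k, `|H k p - H k p'| <= M%:R^-1.

(** A point is labelled by the set of its nonzero weights and by the rounding of
    all but the first of them. The weights sum to 1, so the omitted weight costs
    nothing, and only [e] numbers are left: this is where the dimension of a
    simplex with [e + 1] vertices enters. *)
Lemma partition_labels (R : realType) (P : Type) (E : set P) (I : finType)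
    (w : I -> P -> R) (e : nat) :
  (forall i p, 0 <= w i p) -> (forall p, E p -> \sum_i w i p = 1) ->
  (forall p, E p -> (#|[pred i | w i p != 0%R]| <= e.+1)%N) ->
  forall N : nat, (0 < N)%N ->
  exists lab : P -> {set I} * {ffun 'I_e -> 'I_N.+1},
    forall p p', E p -> E p' -> lab p = lab p' ->
      \sum_i `|w i p - w i p'| <= e.*2%:R / N%:R.
Proof.
move=> w0 w1 we N N0.
have w_le1 i p : E p -> w i p <= 1.
  move=> Ep; rewrite -(w1 p Ep) (bigD1 i)//= lerDl.
  by apply: sumr_ge0 => j _; exact: w0.
pose S p : {set I} := finset (fun i => w i p != 0).
have cS p : E p -> (#|S p| <= e.+1)%N.
  by move=> /we; rewrite cardsE.
pose lab p := (S p, [ffun k : 'I_e =>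
  if onth (behead (enum (S p))) k is Some i then inord (Num.truncn (N%:R * w i p))
  else ord0] : {ffun 'I_e -> 'I_N.+1}).
exists lab => p p' Ep Ep' [eS /ffunP el].
have out i : i \notin S p -> w i p - w i p' = 0.
  move=> /[dup]; rewrite {2}eS !inE !negbK => /eqP-> /eqP->.
  by rewrite subrr.
have [i0 [s es]] : exists i0 s, enum (S p) = i0 :: s.
  case E0: (enum (S p)) => [|i0 s]; last by exists i0, s.
  have : \sum_i w i p = 0.
    apply: big1 => i _; apply/eqP; apply: contraTT isT => wi.
    have : i \in enum (S p) by rewrite mem_enum inE.
    by rewrite E0.
  by rewrite w1// => /eqP; rewrite oner_eq0.
have us : uniq (i0 :: s) by rewrite -es enum_uniq.
have sz : (size s <= e)%N by move: (cS p Ep); rewrite cardE es.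
have close i : i \in s -> `|w i p - w i p'| <= N%:R^-1.
  move=> si; have ki : (index i s < e)%N by apply: leq_trans sz; rewrite index_mem.
  have := el (Ordinal ki); rewrite !ffunE /= -eS es /=.
  have -> : onth s (index i s) = Some i.
    by rewrite onthE (nth_map i0) ?index_mem// nth_index.
  move=> /(congr1 val) /=.
  have N0' : 0 < N%:R :> R by rewrite ltr0n.
  have wN q : 0 <= N%:R * w i q by rewrite mulr_ge0 ?ler0n.
  have tr q : E q -> (Num.truncn (N%:R * w i q) < N.+1)%N.
    move=> /(w_le1 i) wq1.
    rewrite truncn_lt_nat// (le_lt_trans (ler_piMr (ler0n _ _) wq1))//.
    by rewrite ltr_nat.
  rewrite !inordK ?tr// => etr.
  have /andP[h1 h2] := truncn_itv (wN p).
  have /andP[h3 h4] := truncn_itv (wN p').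
  rewrite -natr1 in h2; rewrite -etr in h3 h4; rewrite -natr1 in h4.
  have : `|N%:R * (w i p - w i p')| <= 1.
    by rewrite mulrBr ler_norml; apply/andP; split; lra.
  by rewrite normrM ger0_norm ?(ltW N0')// -ler_pdivlMl// mulr1.
have sumS (F : I -> R) : (forall i, i \notin S p -> F i = 0) ->
    \sum_i F i = F i0 + \sum_(i <- s) F i.
  move=> F0; rewrite (bigID (mem (S p)))/= [X in _ + X]big1 ?addr0; last first.
    by move=> i; exact: F0.
  by rewrite -big_enum es big_cons.
have sum_s : \sum_(i <- s) `|w i p - w i p'| <= e%:R / N%:R.
  rewrite big_seq; apply: (le_trans (ler_sum _ close)).
  rewrite -big_seq big_const_seq count_predT iter_addr_0 -[X in X <= _]mulr_natl.
  by rewrite ler_wpM2r ?invr_ge0 ?ler0n// ler_nat.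
rewrite sumS; last by move=> i /out ->; rewrite normr0.
rewrite -addnn natrD mulrDl lerD//.
have wi0 q : S q = S p -> E q -> w i0 q = 1 - \sum_(i <- s) w i q.
  move=> Sq Eq; rewrite -(w1 q Eq) (sumS (w^~ q)) ?addrK// => i.
  by rewrite -Sq inE negbK => /eqP.
have subsub (a b : R) : 1 - a - (1 - b) = b - a by ring.
rewrite !wi0// subsub -sumrB.
apply: le_trans (ler_norm_sum _ _ _) _.
by under eq_bigr => i _ do rewrite distrC.
Qed.

(** The cover to be refined consists of the sets where [f] is within [1 / n] of
    a given point of the grid of mesh [1 / n]; the approximation sends each
    member of the refinement to such a grid point and interpolates by a partition
    of unity. *)
Lemma nerve_approx (R : realType) (X : metricType R) (E : set X) (e : nat)
    (J : finType) (f : J -> X -> R) (n : nat) :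
  closed E -> dim_le E e -> (0 < n)%N ->
  (forall j, continuous (f j)) -> (forall j x, 0 <= f j x <= 1) ->
  exists g : J -> X -> R, [/\ forall j, continuous (g j),
    forall j x, E x -> `|g j x - f j x| <= n%:R^-1 & box_dim_le E g e].
Proof.
move=> clE dimE n0 cf f01.
have n0' : 0 < n%:R :> R by rewrite ltr0n.
pose W (z : {ffun J -> 'I_n.+1}) :=
  [set x | forall j, `|(z j)%:R / n%:R - f j x| < n%:R^-1].
have oW z : open (W z).
  rewrite openE => x Wx; apply: filter_forall => j.
  apply: (cvgr_lt `|(z j)%:R / n%:R - f j x|); last exact: Wx.
  by apply: cvg_norm; apply: cvgB; [exact: cvg_cst|exact: cf].
have [x _|I [V [z [oV VW covV multV]]]] := dimE _ W oW.
  exists [ffun j => inord (Num.truncn (n%:R * f j x))] => j /=.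
  have /andP[f0 f1] := f01 j x.
  have nf0 : 0 <= n%:R * f j x by rewrite mulr_ge0 ?ler0n.
  have tn : (Num.truncn (n%:R * f j x) < n.+1)%N.
    rewrite truncn_lt_nat// (le_lt_trans (ler_piMr (ler0n _ _) f1))//.
    by rewrite ltr_nat.
  rewrite ffunE inordK//; have /andP[h1 h2] := truncn_itv nf0.
  rewrite -natr1 in h2; set t : R := (Num.truncn _)%:R in h1 h2 *.
  have -> : t / n%:R - f j x = (t - n%:R * f j x) / n%:R.
    by field; rewrite gt_eqF.
  have n'0 : 0 < n%:R^-1 :> R by rewrite invr_gt0.
  rewrite normrM (gtr0_norm n'0) gtr_pMl// ltr_norml.
  by apply/andP; split; lra.
(* Adding the distance to [E] keeps the denominator positive off [E] without
   changing anything on [E]. *)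
have [phi0 [cphi0 phi0_ge0 phi0E]] := closed_zero_set clE.
have /choice[phi phiP] : forall i, exists phi : X -> R,
    [/\ continuous phi, forall x, 0 <= phi x & forall x, phi x = 0 <-> (~` V i) x].
  by move=> i; apply: closed_zero_set; exact: open_closedC.
have cphi i : continuous (phi i) by have [] := phiP i.
have phi_ge0 i x : 0 <= phi i x by have [] := phiP i.
have phiV i x : phi i x = 0 <-> ~ V i x by have [] := phiP i.
pose den x := phi0 x + \sum_i phi i x.
have den_gt0 x : 0 < den x.
  have [Ex|nEx] := pselect (E x).
    have [i Vi] := covV x Ex.
    rewrite /den (bigD1 i)//= addrCA ltr_wpDr ?addr_ge0// ?sumr_ge0//.
    by rewrite lt_neqAle phi_ge0 andbT eq_sym; apply/eqP => /phiV.
  rewrite /den ltr_wpDr ?sumr_ge0// lt_neqAle phi0_ge0 andbT eq_sym.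
  by apply/eqP => /phi0E.
have cden : continuous den.
  by move=> x; apply: cvgD; [exact: cphi0|exact: continuous_sumr].
pose w i x := phi i x / den x.
have cw i : continuous (w i).
  move=> x; apply: cvgM; first exact: cphi.
  by apply: cvgV; [rewrite gt_eqF|exact: cden].
have w_ge0 i x : 0 <= w i x by rewrite divr_ge0// ltW.
have w1 x : E x -> \sum_i w i x = 1.
  move=> Ex; rewrite -mulr_suml /den.
  have /phi0E phi00 := Ex.
  by rewrite phi00 add0r divff// gt_eqF//; move: (den_gt0 x); rewrite /den phi00 add0r.
have wV i x : w i x != 0 -> V i x.
  by rewrite mulf_eq0 negb_or => /andP[/eqP h _]; apply: contrapT => /phiV.
pose c i j : R := (z i j)%:R / n%:R.
have c01 i j : 0 <= c i j <= 1.
  by rewrite divr_ge0 ?ler0n//= ler_pdivrMr// mul1r ler_nat -ltnS.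
exists (fun j x => \sum_i w i x * c i j); split.
- move=> j; apply: continuous_sumr => i _ x.
  by apply: cvgM; [exact: cw|exact: cvg_cst].
- move=> j x Ex.
  have avg (t : R) : t = \sum_i w i x * t by rewrite -mulr_suml w1// mul1r.
  rewrite [f j x]avg -sumrB; apply: le_trans (ler_norm_sum _ _ _) _.
  rewrite [leRHS]avg; apply: ler_sum => i _.
  rewrite -mulrBr normrM ger0_norm//.
  have [->|/wV Vi] := eqVneq (w i x) 0; first by rewrite !mul0r.
  by apply: ler_wpM2l => //; apply: ltW; exact: (VW i x Vi j).
exists (2 ^ #|I| * (e.*2.+2) ^ e)%N => M M0.
have we x : E x -> (#|[pred i | w i x != 0%R]| <= e.+1)%N.
  move=> Ex; apply: leq_trans (multV x Ex); apply: subset_leq_card.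
  by apply/fintype.subsetP => i; rewrite !inE => /wV Vi; exact: Vi.
have M'0 : (0 < e.*2.+1 * M)%N by rewrite muln_gt0.
have [lab labP] := partition_labels w_ge0 w1 we M'0.
exists ({set I} * {ffun 'I_e -> 'I_(e.*2.+1 * M).+1})%type, lab; split.
  rewrite card_prod card_ffun !card_ord -cardsT -powersetT card_powerset cardsT.
  rewrite -mulnA leq_mul2l -expnMn; apply/orP; right.
  by case: (e) => [|e']; rewrite ?expn0// leq_exp2r//; nia.
move=> x y Ex Ey /(labP x y Ex Ey) xy j.
rewrite -sumrB; apply: le_trans (ler_norm_sum _ _ _) _.
apply: (@le_trans _ _ (\sum_i `|w i x - w i y|)).
  apply: ler_sum => i _; rewrite -mulrBl normrM ler_piMr//.
  by have /andP[c0 c1] := c01 i j; rewrite ger0_norm.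
apply: le_trans xy _.
rewrite natrM ler_pdivrMr ?mulr_gt0 ?ltr0n// mulrCA mulVf ?pnatr_eq0 -?lt0n// mulr1.
by rewrite ler_nat.
Qed.

(** * Avoiding values of functions of small box dimension *)

(** Otherwise every point of a grid with [L ^ #|Q|] points in a cube of side [eta]
    would be attained. The constants make the spacing [eta / L] exceed the
    diameter [1 / (a * L)] of the pieces and [L ^ #|Q|] exceed their number
    [C * (a * L) ^ e]; two grid points in one piece are then a contradiction. *)
Lemma box_dim_avoid (R : realType) (P : Type) (Q : finType) (S : set P)
    (H : Q -> P -> R) (e : nat) (eta : R) :
  box_dim_le S H e -> (e < #|Q|)%N -> 0 < eta ->
  exists q : Q -> R, (forall k, 0 <= q k <= eta) /\
    forall p, S p -> exists k, H k p <> q k.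
Proof.
move=> [C HC] eQ eta0; apply: contrapT => nq.
have hit (q : Q -> R) : (forall k, 0 <= q k <= eta) ->
    exists p, S p /\ forall k, H k p = q k.
  move=> q01; apply: contrapT => np; apply: nq; exists q; split => // p Sp.
  apply: contrapT => nk; apply: np; exists p; split => // k.
  by apply: contrapT => Hk; apply: nk; exists k.
pose a := (Num.truncn (eta^-1)).+1.
have a_eta : 1 < a%:R * eta.
  rewrite -ltr_pdivrMr// mul1r.
  exact: truncnS_gt.
pose L := (C * a ^ e).+1.
have [|T [lab [cT labP]]] := HC (a * L)%N; first by rewrite muln_gt0.
have L0 : 0 < L%:R :> R by rewrite ltr0n.
pose q (z : {ffun Q -> 'I_L}) k : R := eta * ((z k)%:R / L%:R).
have q01 z k : 0 <= q z k <= eta.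
  have h : 0 <= ((z k)%:R / L%:R : R) <= 1.
    by rewrite divr_ge0 ?ler0n//= ler_pdivrMr// mul1r ler_nat ltnW.
  by case/andP: h => h0 h1; rewrite /q mulr_ge0 ?(ltW eta0)//= ler_piMr// ltW.
have /choice[p pP] := fun z => hit (q z) (q01 z).
have /injectivePn[z [z' zz' eqlab]] : ~~ injectiveb (lab \o p).
  apply/negP => /injectiveP/leq_card; rewrite card_ffun card_ord leqNgt => /negP.
  apply; apply: leq_ltn_trans cT _; rewrite expnMn mulnA.
  apply: (@leq_trans (L ^ e.+1)%N); last exact: leq_pexp2l.
  by rewrite expnS ltn_pmul2r// expn_gt0.
have [k zk] : exists k, z k != z' k.
  apply/existsP; rewrite -[[exists _, _]]negbK negb_exists; apply/negP => /forallP h.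
  by move/eqP: zz'; apply; apply/ffunP => k; apply/eqP; have := h k; rewrite negbK.
have [[Sz Hz] [Sz' Hz']] := (pP z, pP z').
have := labP _ _ Sz Sz' eqlab k; rewrite Hz Hz' /q -mulrBr -mulrBl.
have L'0 : 0 < L%:R^-1 :> R by rewrite invr_gt0.
have a0 : 0 < a%:R :> R by rewrite ltr0n.
rewrite !normrM (gtr0_norm eta0) (gtr0_norm L'0).
set D := `|_ - _|; have D1 : 1 <= D.
  have : (z k : nat) != z' k by [].
  rewrite /D; case: ltngtP => // lt _; [rewrite distrC|];
    by rewrite -natrB ?(ltnW lt)// normr_nat ler1n subn_gt0.
apply/negP; rewrite -ltNge natrM invfM mulrA ltr_pM2r//.
rewrite -[ltLHS]mul1r ltr_pdivrMr//.
have -> : eta * D * a%:R = a%:R * eta * D by ring.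
by apply: (lt_le_trans a_eta); rewrite ler_peMr// mulr_ge0// ltW.
Qed.

(** The parameters [p false] and [p true] vary independently, so the exponents
    add up; the bound for products of two strata comes from here, without a
    product theorem for covering dimension. *)
Lemma box_dim_difference (R : realType) (X : Type) (U : bool -> set X)
    (J Q : Type) (g : bool -> J -> X -> R) (e : bool -> nat)
    (b b' : Q -> bool) (l l' : Q -> J) :
  (forall c, box_dim_le (U c) (g c) (e c)) ->
  box_dim_le [set p : bool -> X | forall c, U c (p c)]
    (fun k p => g (b k) (l k) (p (b k)) - g (b' k) (l' k) (p (b' k)))
    (e false + e true).
Proof.
move=> dimg; have [C0 hC0] := dimg false; have [C1 hC1] := dimg true.
exists (C0 * C1 * 2 ^ (e false + e true))%N => M M0.
have M2 : (0 < 2 * M)%N by rewrite muln_gt0.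
have [T0 [lab0 [cT0 lab0P]]] := hC0 _ M2.
have [T1 [lab1 [cT1 lab1P]]] := hC1 _ M2.
exists (T0 * T1)%type, (fun p => (lab0 (p false), lab1 (p true))); split.
  rewrite card_prod; apply: leq_trans (leq_mul cT0 cT1) _.
  rewrite !expnMn !expnD; apply: eq_leq; ring.
move=> p p' Up Up' [e0 e1] k.
have close c j : `|g c j (p c) - g c j (p' c)| <= (2 * M)%:R^-1.
  by case: c; [exact: lab1P|exact: lab0P].
have -> : M%:R^-1 = (2 * M)%:R^-1 + (2 * M)%:R^-1 :> R.
  by rewrite natrM; field; rewrite pnatr_eq0 -lt0n.
have -> (x y x' y' : R) : x - y - (x' - y') = (x - x') - (y - y') by ring.
by apply: le_trans (ler_normB _ _) _; apply: lerD.
Qed.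

(** The edges [s i -> t i] form a forest because every vertex is the source of at
    most one of them and [rank] increases along them. The potential of a vertex
    is the sum of [q] along the path that starts there. *)
Lemma forest_potential (R : realType) (V I : finType) (s t : I -> V)
    (rank : V -> nat) (q : I -> R) (eta : R) :
  injective s -> (forall i, rank (s i) < rank (t i))%N ->
  0 <= eta -> (forall i, `|q i| <= eta) ->
  exists p : V -> R, (forall i, p (s i) - p (t i) = q i) /\
    forall v, `|p v| <= (\max_v rank v).+1%:R * eta.
Proof.
move=> s_inj s_t eta0 q_eta; set N := \max_v rank v.
pose fix P (n : nat) (v : V) {struct n} : R := if n isn't n'.+1 then 0 else
  if [pick i | s i == v] is Some i then q i + P n' (t i) else 0.
have Ps n i : P n.+1 (s i) = q i + P n (t i).
  by rewrite /=; case: pickP => [i' /eqP/s_inj->//|/(_ i)]; rewrite eqxx.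
have P_le n v : `|P n v| <= n%:R * eta.
  elim: n v => [|n IH] v /=; first by rewrite normr0 mul0r.
  case: pickP => [i _|_]; last by rewrite normr0 mulr_ge0.
  by rewrite -natr1 mulrDl mul1r addrC (le_trans (ler_normD _ _))// lerD.
have P_stable n v : (N < n + rank v)%N -> P n.+1 v = P n v.
  elim: n v => [|n IH] v.
    by rewrite add0n ltnNge leq_bigmax.
  move=> Nn; case: (pickP (fun i => s i == v)) => [i /eqP sv|nv].
    rewrite -sv in Nn *; rewrite !Ps IH//; have := s_t i; lia.
  by rewrite /=; case: pickP => // i; rewrite nv.
exists (P N.+1); split=> [i|v]; last exact: P_le.
by rewrite Ps P_stable ?addrK// -[ltnLHS]addn0 ltn_add2l (leq_trans _ (s_t i)).
Qed.

(** * Perturbation along a forest of equations *)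

(** The vertices [v] are represented by homeomorphisms [tau v], applied to one of
    two independent parameters, and sweep out disjoint closed sets. Near such a
    set, [F] is replaced by an approximation through a nerve plus a constant
    [p j v]; a solution of all equations would exhibit the differences of these
    constants along the edges as a value of a family of functions of box dimension
    at most [e false + e true], which is less than the number of equations. *)
Lemma perturbation (R : realType) (X : metricType R) (m : nat)
    (U : bool -> set X) (e : bool -> nat) (V I : finType) (sigma : V -> bool)
    (tau tau' : V -> X -> X) (s t : I -> V) (rank : V -> nat)
    (F : 'I_m -> X -> R) (delta : R) :
  (forall c, closed (U c)) -> (forall c, dim_le (U c) (e c)) ->
  (forall v, continuous (tau v)) -> (forall v, continuous (tau' v)) ->
  (forall v, cancel (tau v) (tau' v)) -> (forall v, cancel (tau' v) (tau v)) ->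
  (forall v w x y, U (sigma v) x -> U (sigma w) y -> tau v x = tau w y -> v = w) ->
  injective s -> (forall i, rank (s i) < rank (t i))%N ->
  (e false + e true < #|I| * m)%N ->
  (forall j, continuous (F j)) -> (forall j x, 0 <= F j x <= 1) -> 0 < delta ->
  exists F' : 'I_m -> X -> R, [/\ forall j, continuous (F' j),
    forall j x, 0 <= F' j x <= 1, forall j x, `|F' j x - F j x| <= delta &
    forall p : bool -> X, (forall c, U c (p c)) -> exists i j,
      F' j (tau (s i) (p (sigma (s i)))) <> F' j (tau (t i) (p (sigma (t i))))].
Proof.
move=> clU dimU ctau ctau' tauK tau'K disj s_inj s_t e_lt cF F01 delta0.
pose eps := Num.min delta 1 / 3.
have [eps0 eps_delta eps1] : [/\ 0 < eps, eps + eps <= delta & eps + eps <= 1].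
  have : 0 < Num.min delta 1 by rewrite lt_min delta0 ltr01.
  have : Num.min delta 1 <= delta by rewrite ge_min lexx.
  have : Num.min delta 1 <= 1 by rewrite ge_min lexx orbT.
  by rewrite /eps => h1 h2 h3; split; lra.
(* Shrinking the cube leaves room for a perturbation of size [eps]. *)
pose f j x := eps + (1 - (eps + eps)) * F j x.
have cf j : continuous (f j).
  move=> x; apply: cvgD; first exact: cvg_cst.
  by apply: cvgM; [exact: cvg_cst|exact: cF].
have f_range j x : eps <= f j x <= 1 - eps.
  by have /andP[F0 F1] := F01 j x; rewrite /f; apply/andP; split; nra.
have f_close j x : `|f j x - F j x| <= eps.
  have /andP[F0 F1] := F01 j x; rewrite /f ler_norml; apply/andP; split; nra.
(* One correction of size [kappa] is made for each vertex. *)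
pose kappa := eps / #|V|.+1%:R.
have kappa0 : 0 < kappa by rewrite divr_gt0.
have kappa_eps : #|V|%:R * kappa <= eps.
  rewrite /kappa mulrCA ler_piMr ?(ltW eps0)// ler_pdivrMr// mul1r.
  by rewrite ler_nat.
pose n := (Num.truncn (2 / kappa)).+1.
have n_kappa : n%:R^-1 <= kappa / 2.
  have n_gt : 2 < n%:R * kappa by rewrite -ltr_pdivrMr//; exact: truncnS_gt.
  by rewrite -[leLHS]mul1r ler_pdivrMr ?ltr0n//; lra.
have /choice[g gP] : forall c, exists g : V * 'I_m -> X -> R,
    [/\ forall l, continuous (g l),
      forall l x, U c x -> `|g l x - f l.2 (tau l.1 x)| <= n%:R^-1 &
      box_dim_le (U c) g (e c)].
  move=> c; apply: (nerve_approx (f := fun l x => f l.2 (tau l.1 x))) => //.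
    by move=> l x; apply: continuous_comp; [exact: ctau|exact: cf].
  move=> l x; have /andP[h1 h2] := f_range l.2 (tau l.1 x).
  by apply/andP; split; lra.
pose eta := kappa / 2 / (\max_v rank v).+1%:R.
have eta0 : 0 < eta by rewrite /eta divr_gt0 ?ltr0n// divr_gt0.
have := @box_dim_difference R X U _ (I * 'I_m)%type g e
  (fun k => sigma (s k.1)) (fun k => sigma (t k.1))
  (fun k => (s k.1, k.2)) (fun k => (t k.1, k.2)).
have dimg c : box_dim_le (U c) (g c) (e c) by have [] := gP c.
move=> /(_ dimg)/box_dim_avoid.
rewrite card_prod card_ord => /(_ _ e_lt eta0)[q [q_eta qP]].
have /choice[p pP] : forall j : 'I_m, exists p : V -> R,
    (forall i, p (s i) - p (t i) = - q (i, j)) /\ forall v, `|p v| <= kappa / 2.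
  move=> j; have [||p [p1 p2]] :=
    @forest_potential R V I s t rank (fun i => - q (i, j)) eta s_inj s_t.
  - exact: ltW.
  - by move=> i; have /andP[q0 q1] := q_eta (i, j); rewrite normrN ger0_norm.
  exists p; split => // v; apply: le_trans (p2 v) _.
  by rewrite /eta mulrCA mulfV ?mulr1.
pose h v j x := g (sigma v) (v, j) (tau' v x) + p j v.
have ch v j : continuous (h v j).
  move=> x; apply: cvgD; last exact: cvg_cst.
  apply: (continuous_comp (ctau' v x)).
  by have [cg _ _] := gP (sigma v); exact: cg.
pose C v := tau' v @^-1` U (sigma v).
have clC v : closed (C v) by apply: closed_comp => // x _; exact: ctau'.
have CE v x : C v x -> exists2 u, U (sigma v) u & tau v u = x.
  by move=> Cx; exists (tau' v x) => //; exact: tau'K.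
have /choice[chi chiP] : forall v, exists chi : X -> R,
    [/\ continuous chi, forall x, 0 <= chi x <= 1,
    forall x, C v x -> chi x = 1 &
    forall x, (\bigcup_(w in [set w | w != v]) C w) x -> chi x = 0].
  move=> v; apply: closed_separation => //.
    apply: closed_bigcup => [|w _]; last exact: clC.
    exact: finite_finset.
  move=> x /CE[u Uu eu] [w /= + /CE[u' Uu' eu']]; move/eqP; apply.
  by apply/esym/(disj _ _ u u') => //; rewrite eu.
pose F' j x := f j x + \sum_v chi v x * clamp kappa (h v j x - f j x).
have F'f j x : `|F' j x - f j x| <= eps.
  rewrite /F' addrAC subrr add0r; apply: le_trans kappa_eps.
  apply: le_trans (ler_norm_sum _ _ _) _.
  apply: (@le_trans _ _ (\sum_(v in V) kappa)); last first.
    by rewrite sumr_const mulr_natl.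
  apply: ler_sum => v _; have [_ /(_ x)/andP[c0 c1] _ _] := chiP v.
  rewrite normrM ger0_norm//; apply: (@le_trans _ _ (1 * kappa)).
    by apply: ler_pM => //; apply: clampP; exact: ltW.
  by rewrite mul1r.
have F'h v u j : U (sigma v) u -> F' j (tau v u) = g (sigma v) (v, j) u + p j v.
  move=> Uu; have Cu : C v (tau v u) by rewrite /C /= tauK.
  rewrite /F' (bigD1 v)//= big1 => [|w wv]; last first.
    have [_ _ _ c0] := chiP w; rewrite c0 ?mul0r//.
    by exists v => //=; rewrite eq_sym.
  have [_ _ c1 _] := chiP v; rewrite c1// mul1r addr0 clamp_id; first last.
    have [_ /(_ (v, j) u Uu) /= gu _] := gP (sigma v).
    have [_ /(_ v) pv] := pP j.
    rewrite /h tauK addrAC; apply: le_trans (ler_normD _ _) _.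
    by rewrite [kappa]splitr lerD// (le_trans gu).
  by rewrite addrC subrK /h tauK.
exists F'; split.
- move=> j x; apply: cvgD; first exact: cf.
  apply: continuous_sumr => v _ y; apply: cvgM.
    by have [cchi _ _ _] := chiP v; exact: cchi.
  apply: (@continuous_clamp R X kappa (fun z => h v j z - f j z)) => z.
  by apply: cvgB; [exact: ch|exact: cf].
- move=> j x; have /andP[f0 f1] := f_range j x.
  have := F'f j x; rewrite ler_norml => /andP[h1 h2].
  by apply/andP; split; lra.
- move=> j x; rewrite -(subrK (f j x) (F' j x)) -addrA.
  apply: le_trans (ler_normD _ _) _; apply: le_trans eps_delta.
  exact: lerD.
- move=> u Uu; have [[i j] /= ij] := qP u Uu.
  exists i, j; rewrite !F'h// => eq_ij; apply: ij.
  have [/(_ i) pij _] := pP j; lra.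
Qed.

(** * Orbits of boxes and stabilisers *)

Definition natvec (k : nat) (v : 'I_k -> nat) : 'rV[int]_k := \row_j (v j)%:Z.

Lemma natvecD (k : nat) (v w : 'I_k -> nat) :
  natvec (fun j => v j + w j)%N = natvec v + natvec w.
Proof. by apply/rowP => j; rewrite !mxE PoszD. Qed.

Lemma natvec_sub (k : nat) (a : 'rV[int]_k) :
  exists v w : 'I_k -> nat, a = natvec v - natvec w.
Proof.
exists (fun j => if 0 <= a 0 j then absz (a 0 j) else 0%N).
exists (fun j => if 0 <= a 0 j then 0%N else absz (a 0 j)).
apply/rowP => j; rewrite !mxE; case: ifP => a0; first by rewrite subr0 gez0_abs.
by rewrite sub0r ltz0_abs ?opprK// ltNge a0.
Qed.

(** The proof that [act] is an action is an argument so that the stabiliser can be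
    declared to be a subgroup. *)
Definition stab (k : nat) (X : topologicalType) (act : 'rV[int]_k -> X -> X)
    (act_cont : continuous_action act) (x : X) : {pred 'rV[int]_k} :=
  fun a => act a x == x.

Lemma stab_zmod_closed (k : nat) (X : topologicalType)
    (act : 'rV[int]_k -> X -> X) (act_cont : continuous_action act) (x : X) :
  zmod_closed (stab act_cont x).
Proof.
have [act0 actD _] := act_cont.
split=> [|a b]; rewrite !unfold_in /stab ?act0// => /eqP ax /eqP bx.
by rewrite -{1}bx -actD subrK ax.
Qed.

HB.instance Definition _ (k : nat) (X : topologicalType)
    (act : 'rV[int]_k -> X -> X) (act_cont : continuous_action act) (x : X) :=
  GRing.isZmodClosed.Build _ (stab act_cont x) (stab_zmod_closed act_cont x).

Definition gridvec (k N : nat) (i : {ffun 'I_k -> 'I_N.+1}) : 'rV[int]_k :=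
  natvec (fun j => i j).

Definition orbit_box (k : nat) (X : choiceType) (act : 'rV[int]_k -> X -> X)
    (N : nat) (x : X) : {fset X} :=
  [fset act (gridvec i) x | i : {ffun 'I_k -> 'I_N.+1}]%fset.

Lemma orbit_boxP (k : nat) (X : choiceType) (act : 'rV[int]_k -> X -> X)
    (N : nat) (x z : X) :
  reflect (exists2 v : 'I_k -> nat, (forall j, v j <= N)%N & z = act (natvec v) x)
    (z \in orbit_box act N x).
Proof.
apply: (iffP idP) => [/imfsetP[i _ ->]|[v vN ->]]; last first.
  apply/imfsetP; exists [ffun j => inord (v j)] => //; congr (act _ x).
  by apply/rowP => j; rewrite !mxE ffunE inordK// ltnS.
by exists (fun j => nat_of_ord (i j)) => // j; rewrite -ltnS.
Qed.

(** The points [act v x], [v] in a box of side [n], increase with [n]; if each of the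
    first [N] steps added a point there would be more than [N] of them. *)
Lemma orbit_box_stable (k : nat) (X : choiceType) (act : 'rV[int]_k -> X -> X)
    (N : nat) (x : X) :
  (#|` orbit_box act N x| <= N)%N ->
  exists2 n, (n < N)%N & orbit_box act n.+1 x = orbit_box act n x.
Proof.
have sub n : (orbit_box act n x `<=` orbit_box act n.+1 x)%fset.
  apply/fsubsetP => z /orbit_boxP[v vn ->]; apply/orbit_boxP.
  by exists v => // j; rewrite (leq_trans (vn j)).
move=> cN; apply: contrapT => stay.
suff grow n : (n <= N)%N -> (n < #|` orbit_box act n x|)%N.
  by have := grow N (leqnn N); rewrite ltnNge cN.
elim: n => [_|n IH nN].
  rewrite cardfs_gt0; apply/fset0Pn; exists (act (natvec (fun=> 0%N)) x).
  by apply/orbit_boxP; exists (fun=> 0%N).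
apply: leq_ltn_trans (IH (ltnW nN)) _; apply: fproper_ltn_card.
rewrite fproperEneq sub andbT; apply/eqP => e.
by apply: stay; exists n.
Qed.

Section ActionOrbits.
Variables (k : nat) (X : topologicalType) (act : 'rV[int]_k -> X -> X).
Hypothesis act_cont : continuous_action act.

(** The points [y] subject to this condition form the stratum of [x]: a closed
    set, which the set of points with exactly the coincidences of [x] need not be. *)
Definition same_coincidences (N : nat) (x y : X) :=
  forall v w : 'I_k -> nat, (forall j, v j <= N)%N -> (forall j, w j <= N)%N ->
    act (natvec v) x = act (natvec w) x -> act (natvec v) y = act (natvec w) y.

(** A vector with nonnegative entries is moved into the box one unit step at a
    time; each step uses a coincidence of [x] inside the box of side [n + 1], which
    [y] shares. *)
Lemma reduce_to_box (N n : nat) (x : X) :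
  (n < N)%N -> orbit_box act n.+1 x = orbit_box act n x ->
  forall v, exists2 w : 'I_k -> nat, (forall j, w j <= n)%N &
    forall y, same_coincidences N x y -> act (natvec v) y = act (natvec w) y.
Proof.
move=> nN stable v.
have [_ actD _] := act_cont.
have xx : same_coincidences N x x by [].
have [M] := ubnP (\sum_j v j)%N; elim: M v => // M IH v; rewrite ltnS => vM.
have [v0|/existsP[l vl]] := boolP [forall j, v j == 0%N].
  exists (fun=> 0%N) => // y _; congr (act _ y).
  by apply/rowP => j; rewrite !mxE (eqP (forallP v0 j)).
pose u j := (j == l : nat); pose v' j := (v j - u j)%N.
have vE : v = (fun j => v' j + u j)%N.
  by apply/funext => j; rewrite /v' /u; case: eqP => [->|_] /=; lia.
have [|w' w'n w'P] := IH v'.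
  apply: leq_trans vM; rewrite (bigD1 l)//= [ltnRHS](bigD1 l)//= -addSn.
  apply: leq_add; first by rewrite /v' /u eqxx; lia.
  by apply: leq_sum => j _; exact: leq_subr.
have [w wn wE] : exists2 w : 'I_k -> nat, (forall j, w j <= n)%N &
    act (natvec (fun j => w' j + u j)%N) x = act (natvec w) x.
  have : act (natvec (fun j => w' j + u j)%N) x \in orbit_box act n.+1 x.
    apply/orbit_boxP; eexists; last by reflexivity.
    by move=> j; rewrite -addn1 leq_add// /u leq_b1.
  by rewrite stable => /orbit_boxP[w wn ->]; exists w.
exists w => // y xy.
transitivity (act (natvec (fun j => w' j + u j)%N) y).
  by rewrite [in LHS]vE !natvecD ![_ + natvec u]addrC !actD (w'P y xy).
apply: xy wE => j.
  by apply: leq_trans nN; rewrite -addn1 leq_add// /u leq_b1.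
by rewrite (leq_trans (wn j))// ltnW.
Qed.

(** An element of the stabiliser is a difference of two vectors with nonnegative
    entries that act alike on [x]. Both reduce to the box, where the resulting
    coincidence is shared by [y]. *)
Lemma fixed_of_same_coincidences (N : nat) (x y : X) :
  (#|` orbit_box act N x| <= N)%N -> same_coincidences N x y ->
  fixed_points act (stab act_cont x) y.
Proof.
move=> /orbit_box_stable[n nN stable] xy a.
have [act0 actD _] := act_cont.
rewrite unfold_in => /eqP; have [v [w ->]] := natvec_sub a => fixx.
have vw : act (natvec v) x = act (natvec w) x.
  by rewrite -{2}fixx -actD addrC subrK.
have [v' v'n v'P] := reduce_to_box nN stable v.
have [w' w'n w'P] := reduce_to_box nN stable w.
suff -> : act (natvec v - natvec w) y = act (- natvec w) (act (natvec w) y).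
  by rewrite -actD addNr act0.
rewrite addrC actD; congr (act _ _); rewrite v'P// w'P//; apply: xy.
- by move=> j; rewrite (leq_trans (v'n j))// ltnW.
- by move=> j; rewrite (leq_trans (w'n j))// ltnW.
- by rewrite -v'P// -w'P.
Qed.

(** The finite set of points reached from a box is preserved by the vectors with
    nonnegative entries. They act injectively, hence bijectively on it, so that
    their inverses preserve it as well. *)
Lemma orbit_in_box (N : nat) (x : X) (a : 'rV[int]_k) :
  (#|` orbit_box act N x| <= N)%N -> act a x \in orbit_box act N x.
Proof.
move=> /orbit_box_stable[n nN stable].
have [act0 actD _] := act_cont.
have xx : same_coincidences N x x by [].
suff : act a x \in orbit_box act n x.
  move=> /orbit_boxP[v vn ->]; apply/orbit_boxP; exists v => // j.
  by rewrite (leq_trans (vn j))// ltnW.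
have inO v : act (natvec v) x \in orbit_box act n x.
  have [w wn wP] := reduce_to_box nN stable v.
  by rewrite wP//; apply/orbit_boxP; exists w.
have [v [w ->]] := natvec_sub a; rewrite addrC actD.
set O := orbit_box act n x in inO *.
pose O' := [fset act (natvec w) z | z in O]%fset.
have O'E : O' = O.
  apply/eqP; rewrite eqEfcard; apply/andP; split.
    apply/fsubsetP => _ /imfsetP[_ /orbit_boxP[u _ ->] ->].
    by rewrite -actD -natvecD.
  have w_inj : injective (act (natvec w)).
    by move=> y z /(congr1 (act (- natvec w))); rewrite -!actD addNr !act0.
  by rewrite [leqRHS](card_imfset _ _ w_inj).
have /imfsetP[z zO ->] : act (natvec v) x \in O' by rewrite O'E.
by rewrite -actD addNr act0; exact: zO.
Qed.

Lemma stab_index (N : nat) (x : X) :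
  (#|` orbit_box act N x| <= N)%N ->
  has_index (stab act_cont x) #|` orbit_box act N x|.
Proof.
move=> cN; have [act0 actD _] := act_cont.
rewrite /has_index; pose O := orbit_box act N x; pose coset z := [set h | act h x = z].
have -> : cosets (stab act_cont x) = coset @` [set` O].
  apply/seteqP; split=> [_ [g _ <-]|_ [z /orbit_boxP[v _ ->] <-]].
    exists (act g x); first exact: orbit_in_box.
    apply/seteqP; split=> h; rewrite /coset/= unfold_in /stab.
      by move=> hg; rewrite addrC actD hg -actD addNr act0.
    by move/eqP => hg; rewrite -[in RHS]hg -actD addrC subrK.
  exists (natvec v) => //; apply/seteqP; split=> h; rewrite /coset/= unfold_in /stab.
    by move/eqP => hg; rewrite -[in RHS]hg -actD addrC subrK.
  by move=> hg; rewrite addrC actD hg -actD addNr act0.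
rewrite (card_eql (inj_card_eq _)).
  exact/card_eq_fsetP.
move=> _ z /set_mem/orbit_boxP[v _ ->] _ /seteqP[sub _].
exact: (sub (natvec v)).
Qed.

End ActionOrbits.

(** * Dimension of the strata *)

Lemma dim_le_setT (R : realType) (X : topologicalType) (d : nat) :
  covering_dim R X = d%:R%:E -> dim_le [set: X] d.
Proof.
move=> dimX; have := @dim_le_range R X X idfun d; rewrite image_id; apply.
- exact: cts_fun.
- by move=> U oU; exists U.
- by rewrite dimX lte_fin ltr_nat.
Qed.

Lemma dim_le_subspace (R : realType) (X : topologicalType) (A : set X) (e : nat) :
  (covering_dim R (set_type A) < e.+1%:R%:E)%E -> dim_le A e.
Proof.
move=> dimA; have := @dim_le_range R X (set_type A) set_val e.
rewrite -[X in dim_le X e](_ : A = _); last first.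
  apply/seteqP; split=> [x Ax|_ [x _ <-]]; last exact: set_valP.
  by exists (SigSub (mem_set Ax)).
apply => //.
- exact: initial_continuous.
- by move=> U [U' oU' <-]; exists U'.
Qed.

(** When the box reaches at most [2 * d] points, the stratum of [x] consists of fixed
    points of its stabiliser, whose index is the number of these points. *)
Lemma stratum_dim (R : realType) (k d m : nat) (m_ge1 : (1 <= m)%N)
    (X : metricType R) (act : 'rV[int]_k -> X -> X)
    (act_cont : continuous_action act)
    (dimX : covering_dim R X = d%:R%:E)
    (dim_fixed : forall (A : zmodClosed 'rV[int]_k) (n : nat),
      has_index A n -> (n <= 2 * d)%N ->
      (covering_dim R (set_type (fixed_points act A)) * (n%:R^-1)%:E
         < (m%:R / 2)%:E)%E) (x : X) (E : set X) :
  closed E -> E `<=` [set y | same_coincidences act (2 * d)%N x y] ->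
  exists2 e, dim_le E e & (2 * e < #|` orbit_box act (2 * d)%N x| * m)%N.
Proof.
move=> clE Ex; set a := #|` _|.
have a0 : (0 < a)%N.
  rewrite cardfs_gt0; apply/fset0Pn; exists (act (natvec (fun=> 0%N)) x).
  by apply/orbit_boxP; exists (fun=> 0%N).
have [a_le|a_gt] := leqP a (2 * d)%N; last first.
  exists d; last by rewrite (leq_trans a_gt)// leq_pmulr.
  by apply: dim_le_closed clE _ (dim_le_setT dimX).
exists (a * m).-1./2; last first.
  have : (0 < a * m)%N by rewrite muln_gt0 a0.
  by have := odd_double_half (a * m).-1; lia.
apply: (@dim_le_closed _ (fixed_points act (stab act_cont x))) => //.
  by move=> y /Ex; exact: fixed_of_same_coincidences.
apply: (@dim_le_subspace R).
have := dim_fixed (stab act_cont x) a (stab_index act_cont a_le) a_le.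
have aR : 0 < a%:R :> R by rewrite ltr0n.
rewrite lte_pdivrMr// -EFinM => /lt_le_trans; apply.
rewrite lee_fin mulrAC ler_pdivrMr// -!natrM ler_nat.
have := odd_double_half (a * m).-1; lia.
Qed.

(** * The graph of equations of a pair of points *)

(** Pairs of points are functions on [bool]. In contrast to [same_coincidences]
    this also records the coincidences between the two orbits. *)
Definition keeps_coincidences (k N : nat) (X : Type)
    (act : 'rV[int]_k -> X -> X) (p0 p : bool -> X) :=
  forall c c' (i i' : {ffun 'I_k -> 'I_N.+1}),
    act (gridvec i) (p0 c) = act (gridvec i') (p0 c') ->
    act (gridvec i) (p c) = act (gridvec i') (p c').

(** Sets [K false] and [K true] that are small enough around the two points of [p0]
    for the translates of one or both of them to meet only where this is forced
    by a coincidence of [p0]. *)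
Definition separating (k N : nat) (X : Type) (act : 'rV[int]_k -> X -> X)
    (p0 : bool -> X) (K : bool -> set X) :=
  forall c c' (i i' : {ffun 'I_k -> 'I_N.+1}) x y, K c x -> K c' y ->
    act (gridvec i) x = act (gridvec i') y ->
    act (gridvec i) (p0 c) = act (gridvec i') (p0 c').

Lemma orbit_box_gridP (k : nat) (X : choiceType) (act : 'rV[int]_k -> X -> X)
    (N : nat) (x z : X) :
  reflect (exists i : {ffun 'I_k -> 'I_N.+1}, z = act (gridvec i) x)
    (z \in orbit_box act N x).
Proof.
by apply: (iffP idP) => [/imfsetP[i _ ->]|[i ->]]; [exists i|apply/imfsetP; exists i].
Qed.

Lemma same_coincidencesP (k N : nat) (X : topologicalType)
    (act : 'rV[int]_k -> X -> X) (x y : X) :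
  same_coincidences act N x y <->
  forall i i' : {ffun 'I_k -> 'I_N.+1},
    act (gridvec i) x = act (gridvec i') x -> act (gridvec i) y = act (gridvec i') y.
Proof.
split=> [h i i'|h v w vN wN]; first by apply: h => j; rewrite -ltnS.
have E u : (forall j, u j <= N)%N ->
    natvec u = gridvec [ffun j => inord (u j) : 'I_N.+1] :> 'rV[int]_k.
  by move=> uN; apply/rowP => j; rewrite !mxE ffunE inordK// ltnS.
by rewrite (E v)// (E w)//; exact: h.
Qed.

Lemma closed_eq_fun (R : realType) (T : topologicalType) (X : metricType R)
    (f g : T -> X) :
  continuous f -> continuous g -> closed [set x | f x = g x].
Proof.
move=> cf cg x clx; apply: mdist_positivity; apply/eqP.
rewrite eq_le mdist_ge0 andbT; apply/ler_addgt0Pl => /= r r0; rewrite addr0.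
have r2 : 0 < r / 2 by rewrite divr_gt0.
have near_fg : \forall y \near x,
    mdist (f x) (f y) < r / 2 /\ mdist (g x) (g y) < r / 2.
  by near=> y; split; near: y;
    apply: (metricType_numDomainType.cvgr_dist_lt _ r2); [exact: cf|exact: cg].
have [y [/= fgy [fy gy]]] := clx _ near_fg.
apply: le_trans (metric_triangle _ (f y) _) _.
by rewrite [r]splitr lerD ?ltW// fgy metric_sym.
Unshelve. all: by end_near. Qed.

Lemma closed_same_coincidences (R : realType) (k N : nat) (X : metricType R)
    (act : 'rV[int]_k -> X -> X) (act_cont : continuous_action act) (x : X) :
  closed [set y | same_coincidences act N x y].
Proof.
have [_ _ cact] := act_cont.
rewrite (_ : [set _ | _] = \bigcap_(ii in [set ii : _ * _ |
    act (@gridvec k N ii.1) x = act (gridvec ii.2) x])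
  [set y | act (gridvec ii.1) y = act (@gridvec k N ii.2) y]).
  by apply: closed_bigI => ii _; exact: closed_eq_fun.
apply/seteqP; split=> y /=.
  by move=> /same_coincidencesP h [i i'] /=; exact: h.
by move=> h; apply/same_coincidencesP => i i' ii; exact: (h (i, i')).
Qed.

(** The vertices of the graph are the points that the box reaches from [p0], each
    with a chosen expression in terms of [p0]; the edges are indexed by the points
    of [A]. The pair [p] depends on parameters [u] through [sigma] and [gamma]: each
    point is its own parameter when the orbits are apart, and both are translates
    of the first parameter when they lie in one orbit. *)
Lemma perturb_graph (R : realType) (k N m : nat) (X : metricType R)
    (act : 'rV[int]_k -> X -> X) (act_cont : continuous_action act)
    (p0 : bool -> X) (K U : bool -> set X) (e : bool -> nat)
    (sigma : bool -> bool) (gamma : bool -> 'rV[int]_k) (c0 : bool)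
    (A : {fset X}) (rank : X -> nat) (F : 'I_m -> X -> R) (delta : R) :
  (forall c, closed (U c)) -> (forall c, dim_le (U c) (e c)) ->
  (forall c u, U (sigma c) u -> K c (act (gamma c) u)) ->
  separating N act p0 K ->
  (A `<=` orbit_box act N (p0 c0))%fset ->
  (forall i : {ffun 'I_k -> 'I_N.+1}, act (gridvec i) (p0 c0) \in A ->
    rank (act (gridvec i) (p0 c0)) < rank (act (gridvec i) (p0 (~~ c0))))%N ->
  (e false + e true < #|` A| * m)%N ->
  (forall j, continuous (F j)) -> (forall j x, 0 <= F j x <= 1) -> 0 < delta ->
  exists F' : 'I_m -> X -> R, [/\ forall j, continuous (F' j),
    forall j x, 0 <= F' j x <= 1, forall j x, `|F' j x - F j x| <= delta &
    forall u : bool -> X, (forall c, U c (u c)) ->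
      forall p, (forall c, p c = act (gamma c) (u (sigma c))) ->
      keeps_coincidences N act p0 p -> exists (i : {ffun 'I_k -> 'I_N.+1}) j,
        F' j (act (gridvec i) (p false)) <> F' j (act (gridvec i) (p true))].
Proof.
move=> clU dimU UK sepK sA rankA e_lt cF F01 delta0.
have [act0 actD cact] := act_cont.
pose V := (orbit_box act N (p0 c0) `|` orbit_box act N (p0 (~~ c0)))%fset.
have /choice[nm nmP] : forall v : V, exists ci : bool * {ffun 'I_k -> 'I_N.+1},
    val v = act (gridvec ci.2) (p0 ci.1).
  move=> [v /= vV]; move: vV; rewrite in_fsetU => /orP[] /orbit_box_gridP[i ->].
    by exists (c0, i).
  by exists (~~ c0, i).
have /choice[io ioP] : forall z : A, exists i : {ffun 'I_k -> 'I_N.+1},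
    val z = act (gridvec i) (p0 c0).
  by move=> [z /= zA]; apply/orbit_box_gridP; exact: (fsubsetP sA).
have sV z : act (gridvec (io z)) (p0 c0) \in V.
  by rewrite in_fsetU; apply/orP; left; apply/orbit_box_gridP; eexists.
have tV z : act (gridvec (io z)) (p0 (~~ c0)) \in V.
  by rewrite in_fsetU; apply/orP; right; apply/orbit_box_gridP; eexists.
pose s z : V := [` sV z]%fset; pose t z : V := [` tV z]%fset.
pose w (v : V) := gridvec (nm v).2 + gamma (nm v).1.
have e_lt' : (e false + e true < #|{: A}| * m)%N by rewrite -cardfE.
have [|||||||F' [cF' F'01 F'F F'P]] := @perturbation R X m U e V A
  (fun v => sigma (nm v).1) (fun v => act (w v)) (fun v => act (- w v))
  s t (fun v => rank (val v)) F delta clU dimU _ _ _ _ _ _ _ e_lt' cF F01 delta0.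
- by move=> v; exact: cact.
- by move=> v; exact: cact.
- by move=> v x; rewrite -actD addNr act0.
- by move=> v x; rewrite -actD addrN act0.
- move=> v v' x y Ux Uy; rewrite !actD => /sepK eqvv'.
  apply: val_inj; rewrite nmP [RHS]nmP; apply: eqvv'; exact: UK.
- by move=> z z' /(congr1 val) /=; rewrite -!ioP => /val_inj.
- by move=> z /=; apply: rankA; rewrite -ioP; exact: valP.
exists F'; split => // u Uu p pE pP.
have [z [j zj]] := F'P u Uu; exists (io z), j => eq_ij; apply: zj.
have expr v c (i : {ffun 'I_k -> 'I_N.+1}) : val v = act (gridvec i) (p0 c) ->
    act (w v) (u (sigma (nm v).1)) = act (gridvec i) (p c).
  by move=> vE; rewrite /w actD -pE; apply: pP; rewrite -nmP.
rewrite (expr (s z) c0 (io z))// (expr (t z) (~~ c0) (io z))//.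
move: eq_ij; clear; case: c0 => //= ->.
Qed.

(** * Forests in the graph of equations *)

Lemma dim_le_set1 (X : topologicalType) (x : X) : dim_le [set x] 0.
Proof.
move=> J W oW /(_ x erefl)[j Wj]; have oWj := oW j.
exists unit, (fun=> W j), (fun=> j).
split=> [_|_|y /= ->|y _]; [exact: oWj|by []|by exists tt|].
by rewrite (leq_trans (max_card _))// card_unit.
Qed.

(** Either the box reaches a common point from the two given points, or not. In
    the first case one point is a translate of the other, and the second parameter
    of [perturb_graph] is frozen to a point, which has dimension 0. *)
Lemma local_perturb (R : realType) (k d m : nat) (m_ge1 : (1 <= m)%N)
    (X : metricType R) (act : 'rV[int]_k -> X -> X)
    (act_cont : continuous_action act)
    (dimX : covering_dim R X = d%:R%:E)
    (dim_fixed : forall (A : zmodClosed 'rV[int]_k) (n : nat),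
      has_index A n -> (n <= 2 * d)%N ->
      (covering_dim R (set_type (fixed_points act A)) * (n%:R^-1)%:E
         < (m%:R / 2)%:E)%E)
    (p0 : bool -> X) (K : bool -> set X) (F : 'I_m -> X -> R) (delta : R) :
  p0 false <> p0 true -> (forall c, closed (K c)) ->
  separating (2 * d) act p0 K ->
  (forall j, continuous (F j)) -> (forall j x, 0 <= F j x <= 1) -> 0 < delta ->
  exists F' : 'I_m -> X -> R, [/\ forall j, continuous (F' j),
    forall j x, 0 <= F' j x <= 1, forall j x, `|F' j x - F j x| <= delta &
    forall p, (forall c, K c (p c)) -> keeps_coincidences (2 * d) act p0 p ->
      exists (i : {ffun 'I_k -> 'I_(2 * d).+1}) j,
        F' j (act (gridvec i) (p false)) <> F' j (act (gridvec i) (p true))].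
Proof.
move=> p0_neq clK sepK cF F01 delta0; set N := (2 * d)%N in sepK *.
have [act0 actD cact] := act_cont.
have act_inj a : injective (act a).
  by move=> x y /(congr1 (act (- a))); rewrite -!actD addNr !act0.
have sdim := stratum_dim m_ge1 act_cont dimX dim_fixed.
pose a c := #|` orbit_box act N (p0 c)|.
have keep_same p c : keeps_coincidences N act p0 p ->
    same_coincidences act N (p0 c) (p c).
  by move=> h; apply/same_coincidencesP => i i'; exact: h.
have [[i1 [i2 meet]]|disj] := pselect (exists i1 i2 : {ffun 'I_k -> 'I_N.+1},
    act (gridvec i1) (p0 false) = act (gridvec i2) (p0 true)).
- pose g := gridvec i1 - gridvec i2 : 'rV[int]_k.
  pose gamma (c : bool) := if c then g else 0.
  have meetP p : keeps_coincidences N act p0 p -> p true = act g (p false).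
    move=> /(_ _ _ _ _ meet) e.
    by rewrite /g addrC actD e -actD addNr act0.
  have keep0 : keeps_coincidences N act p0 p0 by [].
  pose U0 := [set y | (K false y /\ K true (act g y)) /\
    same_coincidences act N (p0 false) y].
  have clU0 : closed U0.
    apply: closedI; last exact: closed_same_coincidences.
    apply: closedI; first exact: clK.
    by apply: closed_comp => // x _; exact: cact.
  have [e dime e_lt] := sdim (p0 false) U0 clU0 (@subIsetr _ _ _).
  pose T := act g.
  pose O := orbit_box act N (p0 false).
  pose V := (O `|` orbit_box act N (p0 true))%fset.
  pose idx (z : X) := index z (enum_fset V).
  have TO i : T (act (gridvec i) (p0 false)) = act (gridvec i) (p0 true) :> X.
    by rewrite /T (meetP _ keep0) -!actD addrC.
  have OV z : z \in O -> z \in V by move=> zO; rewrite in_fsetU zO.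
  have TV z : z \in O -> T z \in V.
    move=> /orbit_box_gridP[i ->]; rewrite in_fsetU TO; apply/orP; right.
    by apply/orbit_box_gridP; exists i.
  have Tz z : z \in O -> idx (T z) != idx z.
    move=> zO; apply/eqP => idx_eq.
    have Tz_z : T z = z.
      rewrite -(nth_index z (TV z zO)) -[index _ _]/(idx (T z)) idx_eq.
      exact: nth_index (OV z zO).
    have /orbit_box_gridP[i zE] := zO; apply: p0_neq.
    by apply: (act_inj (gridvec i)); rewrite -TO -zE Tz_z.
  suff [A [rank [sA rankA cA]]] : exists (A : {fset X}) (rank : X -> nat),
      [/\ (A `<=` O)%fset, (forall z, z \in A -> rank z < rank (T z))%N &
        (a false <= 2 * #|` A|)%N].
    have [|||||F' [cF' F'01 F'F F'P]] := @perturb_graph R k N m X act act_cont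
      p0 K (fun c => if c then [set p0 false] else U0)
      (fun c => if c then 0%N else e) (fun=> false) gamma false A rank F delta
      _ _ _ sepK sA _ _ cF F01 delta0.
    + case=> //; apply: accessible_closed_set1; apply: hausdorff_accessible.
      exact: metric_hausdorff.
    + by case=> //; exact: dim_le_set1.
    + by case=> u [[u0 u1] _]; rewrite /gamma ?act0.
    + by move=> i iA; have := rankA _ iA; rewrite TO.
    + rewrite addn0.
      have : (a false * m <= 2 * #|` A| * m)%N by rewrite leq_mul2r cA orbT.
      by move: e_lt; rewrite -/N -/(a false); lia.
    exists F'; split => // p Kp pP.
    apply: (F'P (fun c => if c then p0 false else p false)) => //.
      case=> //; split; last exact: keep_same.
      by split; [exact: Kp|rewrite -meetP//; exact: Kp].
    by case; rewrite /gamma ?act0//; exact: meetP.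
  (* No edge joins a vertex to itself, so one of these two forests contains at
     least half of the edges. *)
  pose A1 := [fset z in O | (idx z < idx (T z))%N]%fset.
  pose A2 := [fset z in O | (idx (T z) < idx z)%N]%fset.
  have A12 : (a false <= #|` A1| + #|` A2|)%N.
    rewrite -cardfsUI; apply: leq_trans (leq_addr _ _); apply: fsubset_leq_card.
    apply/fsubsetP => z zO; rewrite in_fsetU !in_fset /= !inE.
    by have := Tz z zO; rewrite zO /=; case: ltngtP.
  have [A21|A21] := leqP #|` A2| #|` A1|.
    exists A1, idx; split; last by lia.
      by apply/fsubsetP => z; rewrite in_fset => /andP[].
    by move=> z; rewrite in_fset => /andP[].
  exists A2, (fun z => size (enum_fset V) - idx z)%N; split; last by lia.
    by apply/fsubsetP => z; rewrite in_fset => /andP[].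
  move=> z; rewrite in_fset => /andP[zO lt].
  have : (idx z < size (enum_fset V))%N by rewrite index_mem; exact: OV.
  by move: lt; rewrite /= ; lia.
- have [c0 c0_max] : exists c0, (a (~~ c0) <= a c0)%N.
    by have /orP[] := leq_total (a true) (a false); [exists false|exists true].
  pose U c := K c `&` [set y | same_coincidences act N (p0 c) y].
  have clU c : closed (U c).
    by apply: closedI; [exact: clK|exact: closed_same_coincidences].
  have /choice[e eP] : forall c, exists e, dim_le (U c) e /\ (2 * e < a c * m)%N.
    move=> c; have [e ? ?] := sdim (p0 c) (U c) (clU c) (@subIsetr _ _ _).
    by exists e.
  (* A star forest: all edges go from the larger side to the other one. *)
  pose rank z := (z \notin orbit_box act N (p0 c0)) : nat.
  have [|||||F' [cF' F'01 F'F F'P]] := @perturb_graph R k N m X act act_cont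
      p0 K U e id (fun=> 0) c0 (orbit_box act N (p0 c0)) rank F delta
      clU _ _ sepK _ _ _ cF F01 delta0.
  + by move=> c; have [] := eP c.
  + by move=> c u [Ku _]; rewrite act0.
  + exact: fsubset_refl.
  + move=> i iO; rewrite /rank iO /=; case: (boolP (_ \in _)) => // /orbit_box_gridP.
    move=> [i' eii]; exfalso; apply: disj.
    by case: (c0) eii => /= eii; [exists i, i'|exists i', i].
  + have := eP false; have := eP true; have : (a (~~ c0) * m <= a c0 * m)%N.
      by rewrite leq_mul2r c0_max orbT.
    by rewrite -/(a c0); case: (c0) => /= h [_ h1] [_ h2]; lia.
  exists F'; split => // p Kp pP; apply: (F'P p) => // c.
  by split; [exact: Kp|exact: keep_same].
Qed.

(** * The space of maps into the cube *)

Definition coord (R : realType) (m : nat) (X : topologicalType)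
    (f : Cunif X (set_type (cube R m))) (j : 'I_m) (x : X) : R :=
  (\val ((f : continuousType X (set_type (cube R m))) x)) 0 j.

Lemma coord_continuousC (R : realType) (m : nat) (X : topologicalType)
    (f : Cunif X (set_type (cube R m))) j : continuous (coord f j).
Proof.
move=> x; have cf := @cts_fun _ _ (f : continuousType X (set_type (cube R m))).
have cv : continuous (set_val : set_type (cube R m) -> 'rV[R]_m).
  exact: initial_continuous.
have cc := @coord_continuous R 1 m 0 j.
exact: (continuous_comp (continuous_comp (cf x) (cv _)) (cc _)).
Qed.

Lemma coord_itv (R : realType) (m : nat) (X : topologicalType)
    (f : Cunif X (set_type (cube R m))) j x : 0 <= coord f j x <= 1.
Proof. exact: (set_valP ((f : continuousType X (set_type (cube R m))) x)). Qed.

Lemma coord_inj (R : realType) (m : nat) (X : topologicalType)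
    (f : Cunif X (set_type (cube R m))) x y :
  (forall j, coord f j x = coord f j y) ->
  (f : continuousType X (set_type (cube R m))) x =
  (f : continuousType X (set_type (cube R m))) y.
Proof. by move=> fxy; apply: val_inj; apply/rowP => j; exact: fxy. Qed.

Lemma coord_surj (R : realType) (m : nat) (X : topologicalType)
    (F : 'I_m -> X -> R) :
  (forall j, continuous (F j)) -> (forall j x, 0 <= F j x <= 1) ->
  exists f : Cunif X (set_type (cube R m)), forall j x, coord f j x = F j x.
Proof.
move=> cF F01.
have Fcube x : (\row_j F j x) \in cube R m.
  by apply/mem_set => j; rewrite mxE.
pose h x : set_type (cube R m) := SigSub (Fcube x).
have ch : continuous h.
  apply: continuous_comp_initial => x.
  apply/cvg_mx_entourageP => E entE.
  apply: filter_forall => i; apply: filter_forall => j.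
  have nE : nbhs x (F j @^-1` xsection E (F j x)).
    by apply: cF; exact: nbhs_entourage.
  apply: (@filterS _ (nbhs x) _ _ _ _ nE) => y /= /xsectionP; rewrite /= !mxE => Exy.
  exact: mem_set.
exists (mkcts ch : continuousType X (set_type (cube R m))) => j x.
by rewrite /coord /= /mkcts /h /= mxE.
Qed.

Lemma nbhs_Cunif (R : realType) (m : nat) (X : topologicalType)
    (f : Cunif X (set_type (cube R m))) (A : set (Cunif X (set_type (cube R m)))) :
  nbhs f A <-> exists2 eps : R, 0 < eps &
    [set g | forall j x, `|coord f j x - coord g j x| < eps] `<=` A.
Proof.
set Y := set_type (cube R m).
pose ev (g : Cunif X Y) : X -> Y := (g : continuousType X Y).
split=> [[_ [[B oB <-] Bf BA]]|[eps eps0 epsA]].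
  have : nbhs (ev f : {uniform X -> Y}) B by exact: open_nbhs_nbhs.
  move=> /uniform_nbhs[E [entE EB]].
  move: entE; rewrite -entourage_ballE => -[eps /= eps0 epsE].
  exists eps => // g fg; apply: BA; apply: EB => x _; apply: epsE => /=.
  by split=> // i j; rewrite ord1; exact: fg.
have nb : nbhs (ev f : {uniform X -> Y}) [set h | forall x, ball (ev f x) eps (h x)].
  apply/uniform_nbhs; exists [set xy | ball xy.1 eps xy.2]; split.
    exact: (entourage_ball _ (PosNum eps0)).
  by move=> h fh x; exact: fh.
have cev : continuous (fun g : Cunif X Y => (ev g : {uniform X -> Y})).
  exact: initial_continuous.
have nf : nbhs f [set g | forall x, ball (ev f x) eps (ev g x)] := cev f _ nb.
apply: (filterS _ nf) => g fg; apply: epsA => j x.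
by have [_ /(_ 0 j)] := fg x.
Qed.

Definition box_separated (R : realType) (k N m : nat) (X : topologicalType)
    (act : 'rV[int]_k -> X -> X) (S : set (bool -> X)) :
    set (Cunif X (set_type (cube R m))) :=
  [set f | forall p, S p -> exists (i : {ffun 'I_k -> 'I_N.+1}) j,
    coord f j (act (gridvec i) (p false)) <> coord f j (act (gridvec i) (p true))].

(** On a compact set of pairs, the sum of the distances between the coordinates of
    the two images has a positive minimum, which survives small perturbations. *)
Lemma open_box_separated (R : realType) (k N m : nat) (X : topologicalType)
    (act : 'rV[int]_k -> X -> X) (act_cont : continuous_action act)
    (S : set (bool -> X)) (S2 : set (X * X)) :
  compact S2 -> (forall p, S p <-> S2 (p false, p true)) ->
  open (@box_separated R k N m X act S).
Proof.
move=> cS SE; rewrite openE => f fS; apply/nbhs_Cunif.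
have [_ _ cact] := act_cont.
pose gap (g : Cunif X (set_type (cube R m))) (xy : X * X) : R :=
  \sum_(ij : {ffun 'I_k -> 'I_N.+1} * 'I_m)
    `|coord g ij.2 (act (gridvec ij.1) xy.1) - coord g ij.2 (act (gridvec ij.1) xy.2)|.
have cgap : continuous (gap f).
  apply: continuous_sumr => ij _ xy; apply: cvg_norm; apply: cvgB.
    apply: (@cvg_comp _ _ _ (fun xy : X * X => act (gridvec ij.1) xy.1)
      (coord f ij.2)); last exact: coord_continuousC.
    by apply: (@cvg_comp _ _ _ fst); [exact: cvg_fst|exact: cact].
  apply: (@cvg_comp _ _ _ (fun xy : X * X => act (gridvec ij.1) xy.2)
    (coord f ij.2)); last exact: coord_continuousC.
  by apply: (@cvg_comp _ _ _ snd); [exact: cvg_snd|exact: cact].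
have [S0|/set0P[xy0 Sxy0]] := eqVneq S2 set0.
  exists 1 => // g _ p /SE; by rewrite S0.
have [xy1 S1 gap_min] : exists2 xy1, S2 xy1 & forall xy, S2 xy -> gap f xy1 <= gap f xy.
  have [||c Sc h] := @compact_EVT_min _ R (gap f) S2 _ cS.
  - by exists xy0.
  - exact: continuous_subspaceT.
  - by exists c => [|xy Sxy]; [exact: set_mem|apply: h; exact: mem_set].
have gap0 : 0 < gap f xy1.
  have [|i [j /eqP ij]] := fS (fun c => if c then xy1.2 else xy1.1).
    by apply/SE; rewrite -surjective_pairing.
  rewrite /gap (bigD1 (i, j))//= ltr_wpDr ?sumr_ge0//.
  by rewrite normr_gt0 subr_eq0.
pose n := #|{: {ffun 'I_k -> 'I_N.+1} * 'I_m}|.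
pose eps := gap f xy1 / n.+1%:R / 2.
have eps0 : 0 < eps by rewrite divr_gt0// divr_gt0.
exists eps => // g fg p /SE Sp; apply: contrapT => same.
have := gap_min _ Sp; apply/negP; rewrite -ltNge.
apply: (@le_lt_trans _ _ (\sum_(ij : {ffun 'I_k -> 'I_N.+1} * 'I_m) (eps + eps))).
  apply: ler_sum => -[i j] _ /=.
  have gij : coord g j (act (gridvec i) (p false)) =
      coord g j (act (gridvec i) (p true)).
    by apply: contrapT => ne; apply: same; exists i, j.
  have h1 := fg j (act (gridvec i) (p false)).
  have h2 := fg j (act (gridvec i) (p true)).
  rewrite -gij in h2; move: h1 h2; rewrite !ltr_norml ler_norml.
  by move=> /andP[? ?] /andP[? ?]; apply/andP; split; lra.
rewrite sumr_const -splitr -[ltLHS]mulr_natl mulrCA gtr_pMr//.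
by rewrite ltr_pdivrMr// mul1r ltr_nat.
Qed.

(** * Countable covers and the Baire property *)

(** Closed balls of radius [1 / (n + 1)] around the points of a finite net. *)
Lemma countable_small_closed_sets (R : realType) (X : metricType R) :
  compact [set: X] -> exists K : nat * nat -> set X, (forall t, closed (K t)) /\
    forall x r, 0 < r -> exists2 t, K t x & forall y, K t y -> mdist x y < r.
Proof.
move=> cX.
have /choice[s sP] : forall n : nat, exists s : seq X,
    forall x, exists2 c, c \in s & mdist c x < n.+1%:R^-1.
  move=> n; apply: contrapT => no_net.
  have e0 : 0 < n.+1%:R^-1 :> R by rewrite invr_gt0.
  pose away (t : seq X) := [set x | forall c, c \in t -> ~ mdist c x < n.+1%:R^-1].
  have away_neq0 t : away t !=set0.
    apply: contrapT => t0; apply: no_net; exists t => x.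
    apply: contrapT => xt; apply: t0; exists x => c ct cx.
    by apply: xt; exists c.
  have away_filter : ProperFilter (filter_from setT away).
    apply: filter_from_proper; last by move=> t _; exact: away_neq0.
    apply: filter_from_filter; first by exists [::].
    move=> t1 t2 _ _; exists (t1 ++ t2) => // x h; split=> c ct; apply: h;
      by rewrite mem_cat ct ?orbT.
  have [|x [_ clx]] := cX _ away_filter; first exact: filterT.
  have [||y [yx xy]] := clx (away [:: x]) [set y | mdist x y < n.+1%:R^-1].
  - by exists [:: x].
  - by apply/metricType_numDomainType.nbhs_mdistP; exists n.+1%:R^-1.
  - by apply: (yx x) => //; rewrite mem_head.
pose K t := [set y | exists2 c, onth (s t.1) t.2 = Some c & mdist c y <= t.1.+1%:R^-1].
exists K; split=> [[n i]|x r r0].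
  rewrite /K/=; case: (onth (s n) i) => [c|]; last first.
    rewrite (_ : [set _ | _] = set0) ?closed0//; first exact: closed0.
    by apply/seteqP; split=> // y [].
  move=> y cly; exists c => //; apply/ler_addgt0Pr => /= e e0.
  have [|z [[_ [<-] cz] yz]] := cly [set z | mdist y z < e].
    by apply/metricType_numDomainType.nbhs_mdistP; exists e.
  apply: le_trans (metric_triangle c z y) _.
  by rewrite lerD// metric_sym ltW.
pose n := Num.truncn (2 / r).
have nr : n.+1%:R^-1 + n.+1%:R^-1 < r.
  have : 2 / r < n.+1%:R by exact: truncnS_gt.
  rewrite ltr_pdivrMr// => h.
  by rewrite -[X in X + _]mul1r -[X in _ + X]mul1r -mulrDl ltr_pdivrMr//; lra.
have [c /onthP[i ci] cx] := sP n x; exists (n, i).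
  by exists c => //; exact: ltW.
move=> y [c']; rewrite /= ci => -[<-] cy; apply: le_lt_trans nr.
by apply: le_trans (metric_triangle x c y) _; rewrite lerD// metric_sym ltW.
Qed.

Lemma separating_radius (R : realType) (k N : nat) (X : metricType R)
    (act : 'rV[int]_k -> X -> X) (act_cont : continuous_action act)
    (p0 : bool -> X) :
  exists2 r : R, 0 < r & forall K : bool -> set X,
    (forall c x, K c x -> mdist (p0 c) x < r) -> separating N act p0 K.
Proof.
have [_ _ cact] := act_cont.
pose good (q : (bool * bool) * ({ffun 'I_k -> 'I_N.+1} * {ffun 'I_k -> 'I_N.+1}))
    (r : R) := forall x y, mdist (p0 q.1.1) x < r -> mdist (p0 q.1.2) y < r ->
  act (gridvec q.2.1) x = act (gridvec q.2.2) y ->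
  act (gridvec q.2.1) (p0 q.1.1) = act (gridvec q.2.2) (p0 q.1.2).
have good_near q : \forall r \near 0^'+, good q r.
  case: q => -[c c'] [i i']; rewrite /good/=.
  set a := act _ (p0 c); set b := act _ (p0 c').
  have [ab|/eqP ab] := eqVneq a b; first by near=> r.
  have D0 : 0 < mdist a b / 2 by rewrite divr_gt0// mdist_gt0; exact/eqP.
  have near1 := metricType_numDomainType.cvgr_dist_lt (cact (gridvec i) (p0 c)) D0.
  have near2 := metricType_numDomainType.cvgr_dist_lt (cact (gridvec i') (p0 c')) D0.
  have [e1 /= e10 h1] := (metricType_numDomainType.nbhs_mdistP _ _).1 (near1 _).
  have [e2 /= e20 h2] := (metricType_numDomainType.nbhs_mdistP _ _).1 (near2 _).
  near=> r => x y cx cy xy; exfalso.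
  have r1 : r < e1 by near: r; exact: nbhs_right_lt.
  have r2 : r < e2 by near: r; exact: nbhs_right_lt.
  have h1x := h1 x (lt_trans cx r1); have h2y := h2 y (lt_trans cy r2).
  rewrite /= -/a in h1x; rewrite /= -/b -xy metric_sym in h2y.
  have := metric_triangle a (act (gridvec i) x) b.
  by rewrite leNgt => /negP; apply; rewrite [ltRHS]splitr ltrD.
have all_good : \forall r \near (0 : R)^'+, forall q, good q r.
  exact: filter_forall.
near (0 : R)^'+ => r; exists r; first by near: r; exact: nbhs_right_gt.
move=> K Kr c c' i i' x y Kx Ky xy.
have r_good : forall q, good q r by near: r.
by apply: (r_good ((c, c'), (i, i')) x y) => //=; exact: Kr.
Unshelve. all: by end_near. Qed.

Lemma nowhere_denseC (T : topologicalType) (G : set T) :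
  open G -> dense G -> nowhere_dense (~` G).
Proof.
move=> oG dG; rewrite /nowhere_dense.
have -> : closure (~` G) = ~` G by apply/esym/closure_id; exact: open_closedC.
apply/seteqP; split=> // f fG.
have [g [/interior_subset nGg Gg]] :=
  dG (interior (~` G)) (ex_intro _ f fG) (open_interior _).
exact: nGg Gg.
Qed.

(** Only the open sets of the family that are dense have to be intersected; this
    avoids deciding beforehand which members of the family are dense. *)
Lemma comeagre_bigcap (T : topologicalType) (J : countType) (G : J -> set T)
    (A : set T) :
  (forall t, open (G t)) -> (forall f, A f <-> forall t, dense (G t) -> G t f) ->
  comeagre A.
Proof.
move=> oG AE.
pose F (n : nat) : set T := if @choice.unpickle J n is Some t then
  [set f | dense (G t) /\ ~ G t f] else set0.
exists F; split=> [n|].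
  rewrite /F; case: (choice.unpickle n) => [t|]; last first.
    by rewrite /nowhere_dense closure0 interior0.
  have [dG|ndG] := pselect (dense (G t)).
    rewrite (_ : [set _ | _] = ~` G t); first exact: nowhere_denseC.
    by apply/seteqP; split=> f //= [].
  rewrite (_ : [set _ | _] = set0); first by rewrite /nowhere_dense closure0 interior0.
  by apply/seteqP; split=> f //= [].
apply/seteqP; split=> f.
  by move=> /AE Gf [n _]; rewrite /F; case: (choice.unpickle n) => [t [/Gf]|].
move=> nF; apply/AE => t dG; apply: contrapT => nG; apply: nF.
by exists (choice.pickle t) => //; rewrite /F choice.pickleK.
Qed.

(** * Comeagre many embeddings *)

(** Patterns of coincidences are finite sets, so that together with the closed sets
    of a countable family they index countably many strata. *)
Definition stratum (k N : nat) (X : Type) (act : 'rV[int]_k -> X -> X)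
    (K : bool -> set X)
    (P : {set (bool * {ffun 'I_k -> 'I_N.+1}) * (bool * {ffun 'I_k -> 'I_N.+1})}) :
    set (bool -> X) :=
  [set p | (forall c, K c (p c)) /\ forall ab, ab \in P ->
    act (gridvec ab.1.2) (p ab.1.1) = act (gridvec ab.2.2) (p ab.2.1)].

Lemma open_box_separated_stratum (R : realType) (k N m : nat) (X : metricType R)
    (act : 'rV[int]_k -> X -> X) (act_cont : continuous_action act)
    (K : bool -> set X) P :
  compact [set: X] -> (forall c, closed (K c)) ->
  open (@box_separated R k N m X act (@stratum k N X act K P)).
Proof.
move=> cX clK; have [_ _ cact] := act_cont.
pose pr c (xy : X * X) := if c then xy.2 else xy.1.
have cpr c : continuous (pr c) by case: c => xy; [exact: cvg_snd|exact: cvg_fst].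
apply: (@open_box_separated R k N m X act act_cont _
  ((\bigcap_(c in [set: bool]) (pr c @^-1` K c)) `&`
   \bigcap_(ab in [set` P]) [set xy |
     act (gridvec ab.1.2) (pr ab.1.1 xy) = act (gridvec ab.2.2) (pr ab.2.1 xy)])).
  have cXX : compact [set: X * X] by rewrite -setXTT; exact: compact_setX.
  apply: (subclosed_compact _ cXX) => //; apply: closedI.
    apply: closed_bigI => c _.
    by apply: closed_comp => // xy _; exact: cpr.
  apply: closed_bigI => ab _; apply: closed_eq_fun => xy;
    by apply: (continuous_comp (cpr _ _)); exact: cact.
move=> p; have prE c : pr c (p false, p true) = p c by case: c.
split=> [[pK pP]|[pK pP]]; split=> [c|ab].
- by move=> _ /=; rewrite prE.
- by move=> /pP /=; rewrite !prE.
- by have := pK c I; rewrite /= prE.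
- by move=> /pP /=; rewrite !prE.
Qed.

Lemma dense_box_separated (R : realType) (k d m : nat) (m_ge1 : (1 <= m)%N)
    (X : metricType R) (act : 'rV[int]_k -> X -> X)
    (act_cont : continuous_action act)
    (dimX : covering_dim R X = d%:R%:E)
    (dim_fixed : forall (A : zmodClosed 'rV[int]_k) (n : nat),
      has_index A n -> (n <= 2 * d)%N ->
      (covering_dim R (set_type (fixed_points act A)) * (n%:R^-1)%:E
         < (m%:R / 2)%:E)%E)
    (p0 : bool -> X) (K : bool -> set X) :
  p0 false <> p0 true -> (forall c, closed (K c)) ->
  separating (2 * d) act p0 K ->
  dense (@box_separated R k (2 * d) m X act
    [set p | (forall c, K c (p c)) /\ keeps_coincidences (2 * d) act p0 p]).
Proof.
move=> p0_neq clK sepK O [f Of] oO.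
have /nbhs_Cunif[eps eps0 epsO] : nbhs f O by exact: open_nbhs_nbhs.
have eps2 : 0 < eps / 2 by rewrite divr_gt0.
have [F [cF F01 Ff Fsep]] := local_perturb m_ge1 act_cont dimX dim_fixed p0_neq
  clK sepK (@coord_continuousC _ _ _ f) (@coord_itv _ _ _ f) eps2.
have [g gF] := coord_surj cF F01.
exists g; split.
  apply: epsO => j x; rewrite gF distrC (le_lt_trans (Ff j x))//.
  by rewrite ltr_pdivrMr// ltr_pMr// ltr1n.
move=> p [pK pP]; have [i [j ij]] := Fsep p pK pP.
by exists i, j; rewrite !gF.
Qed.

Lemma orbit_map_eqP (R : realType) (k N m : nat) (X : topologicalType)
    (act : 'rV[int]_k -> X -> X) (f : Cunif X (set_type (cube R m))) (x y : X) :
  orbit_map act N f x = orbit_map act N f y <->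
  forall (i : {ffun 'I_k -> 'I_N.+1}) j,
    coord f j (act (gridvec i) x) = coord f j (act (gridvec i) y).
Proof.
split=> [fxy i j|fxy].
  have iN : gridvec i \in box k N.
    apply/mem_set => l; rewrite mxE; apply/andP; split=> //.
    by rewrite lez_nat -ltnS ltn_ord.
  have := congr1 (@^~ (SigSub iN)) fxy; rewrite /orbit_map /= => e.
  by rewrite /coord e.
apply/funext => -[v v_box]; have vN := set_mem v_box.
rewrite /orbit_map /=; apply: coord_inj => j.
have -> : v = gridvec [ffun l => inord (absz (v 0 l)) : 'I_N.+1].
  apply/rowP => l; have /andP[v0 vl] := vN l.
  rewrite !mxE ffunE inordK ?gez0_abs// ltnS -lez_nat gez0_abs//.
exact: fxy.
Qed.

Theorem theorem4p1 (R : realType) (k d m : nat) (k_ge1 : (1 <= k)%N)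
    (m_ge1 : (1 <= m)%N) (X : metricType R) (X_compact : compact [set: X])
    (act : 'rV[int]_k -> X -> X) (act_cont : continuous_action act)
    (dimX : covering_dim R X = d%:R%:E)
    (dim_fixed : forall (A : zmodClosed 'rV[int]_k) (n : nat),
      has_index A n -> (n <= 2 * d)%N ->
      (covering_dim R (set_type (fixed_points act A)) * (n%:R^-1)%:E
         < (m%:R / 2)%:E)%E) :
  comeagre [set f : Cunif X (set_type (cube R m)) |
    embedding (orbit_map act (2 * d)%N f)].
Proof.
have [K [clK K_small]] := countable_small_closed_sets X_compact.
pose index := ((nat * nat) * (nat * nat) *
  {set (bool * {ffun 'I_k -> 'I_(2 * d).+1}) *
       (bool * {ffun 'I_k -> 'I_(2 * d).+1})})%type.
pose KK (t : index) c := K (if c then t.1.2 else t.1.1).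
pose S (t : index) := stratum act (KK t) t.2.
apply: (@comeagre_bigcap _ index (fun t => @box_separated R k (2 * d) m X act (S t))).
  by move=> t; apply: open_box_separated_stratum => // c; exact: clK.
move=> f; split=> [[_ f_inj] t dG p Sp|Gf].
  (* A dense set is nonempty, and a function that separates all pairs in a stratum
     shows that the stratum contains no pair of equal points. *)
  have [g [_ Gg]] := dG setT (ex_intro _ f I) openT.
  apply: contrapT => nfp; have [i [j]] := Gg p Sp; apply.
  suff -> : p false = p true by [].
  apply: f_inj; apply/orbit_map_eqP => i' j'.
  by apply: contrapT => ne; apply: nfp; exists i', j'.
split.
  have [_ _ cact] := act_cont.
  move=> x; apply/cvg_sup => i.
  apply: (@continuous_comp_initial _ _ _ (@^~ i) (orbit_map act (2 * d) f)) => y.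
  exact: (continuous_comp (cact _ y) (@cts_fun _ _ (f : continuousType _ _) _)).
move=> x y fxy; apply: contrapT => xy.
pose p0 (c : bool) := if c then y else x.
have [r r0 rP] := @separating_radius R k (2 * d) X act act_cont p0.
have [t0 t0x t0r] := K_small x r r0; have [t1 t1y t1r] := K_small y r r0.
pose P := finset (fun ab : (bool * {ffun 'I_k -> 'I_(2 * d).+1}) *
    (bool * {ffun 'I_k -> 'I_(2 * d).+1}) =>
  act (gridvec ab.1.2) (p0 ab.1.1) == act (gridvec ab.2.2) (p0 ab.2.1)).
pose t : index := ((t0, t1), P).
have SE : S t = [set p | (forall c, KK t c (p c)) /\
    keeps_coincidences (2 * d) act p0 p].
  apply/seteqP; split=> p [pK pP]; split=> //.
    by move=> c c' i i' e; apply: (pP ((c, i), (c', i'))); rewrite inE; exact/eqP.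
  by move=> [[c i] [c' i']]; rewrite inE => /eqP; exact: pP.
have dS : dense (@box_separated R k (2 * d) m X act (S t)).
  rewrite SE; apply: dense_box_separated => //.
  - by move=> c; exact: clK.
  - by apply: rP => -[] z; [exact: t1r|exact: t0r].
have [|i [j]] := Gf t dS p0; first by rewrite SE; split=> // -[].
by apply; have /orbit_map_eqP := fxy; apply.
Qed.
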